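(* For almost all $\alpha>0$ (with respect to Lebesgue measure) the following holds: for every starting point $\mathbf{x}=(x_1,x_2)\in I^2$, every convex set $S\subset I^2$ whose boundary $\partial S$ is a twice continuously differentiable curve with positive curvature at every point is a bounded remainder set for the continuous irrational rotation with slope $\alpha$ and starting point $\mathbf{x}$.
   Context: $I=[0,1)$, $I^2=[0,1)^2$, $\{y\}$ denotes the fractional part of $y\in\mathbb{R}$ and $\lambda$ is Lebesgue measure. For irrational $\alpha>0$ and $\mathbf{x}=(x_1,x_2)\in I^2$, the continuous irrational rotation with slope $\alpha$ and starting point $\mathbf{x}$ is $t\mapsto(\{x_1+t\},\{x_2+\alpha t\})$, $t\ge 0$. A measurable set $S\subset I^2$ is a bounded remainder set for this rotation if $\Delta_T(S,\alpha,\mathbf{x})=\int_0^T\chi_S(\{x_1+t\},\{x_2+\alpha t\})\,dt-T\lambda(S)$ is bounded uniformly in $T>0$, where $\chi_S$ is the characteristic function of $S$. The exceptional null set of $\alpha$ does not depend on $S$ or $\mathbf{x}$. *)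

(* Defs.v *)
From HB Require Import structures.
From mathcomp Require Import all_boot all_order all_algebra.
From mathcomp Require Import all_classical all_reals all_analysis.
Set Implicit Arguments.
Unset Strict Implicit.
Unset Printing Implicit Defensive.
Import Order.TTheory GRing.Theory Num.Theory.
Import numFieldNormedType.Exports.
Local Open Scope ring_scope.
Local Open Scope classical_set_scope.

Definition frac_part (R : realType) (y : R) : R := y - (Num.floor y)%:~R.

Definition unit_square (R : realType) : set (R * R) :=
  [set p | 0 <= p.1 < 1 /\ 0 <= p.2 < 1].

(* Lebesgue measure on the plane: the completion (Caratheodory extension) of
   the product of the one-dimensional Borel measures.  A convex set need not
   be Borel, so the product sigma-algebra alone would not be enough. *)
Definition lebesgue_measure2 (R : realType) : set (R * R) -> \bar R :=
  @completed_measure_extension _ _ _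
    ((@lebesgue_measure R) \x (@lebesgue_measure R))%E.

Definition lebesgue_measurable2 (R : realType) (S : set (R * R)) : Prop :=
  (((@lebesgue_measure R) \x (@lebesgue_measure R))^*%mu)%E.-cara.-measurable S.

Definition rotation (R : realType) (alpha : R) (x : R * R) (t : R) : R * R :=
  (frac_part (x.1 + t), frac_part (x.2 + alpha * t)).

Definition discrepancy (R : realType) (S : set (R * R)) (alpha : R)
    (x : R * R) (T : R) : R :=
  \int[@lebesgue_measure R]_(t in `[0, T]) \1_S (rotation alpha x t)
  - T * fine (lebesgue_measure2 S).

(* The first component collects the standing assumptions under which the
   notion is defined. *)
Definition bounded_remainder_set (R : realType) (S : set (R * R)) (alpha : R)
    (x : R * R) : Prop :=
  [/\ 0 < alpha, irrational alpha, unit_square x,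
      S `<=` @unit_square R & lebesgue_measurable2 S] /\
  exists C : R, forall T : R, 0 < T -> `|discrepancy S alpha x T| <= C.

Definition boundary (T : topologicalType) (A : set T) : set T :=
  closure A `\` A°.

Definition twice_continuously_differentiable (R : realType) (f : R -> R) :=
  [/\ forall t, derivable f t 1,
      forall t, derivable (derive1 f) t 1
    & continuous (derive1n 2 f)].

(* Unsigned, hence independent of the orientation of the parametrization. *)
Definition curvature (R : realType) (x y : R -> R) (t : R) : R :=
  `|derive1 x t * derive1n 2 y t - derive1 y t * derive1n 2 x t|
  / Num.sqrt (derive1 x t ^+ 2 + derive1 y t ^+ 2) ^+ 3.

(* (x, y) is a regular L-periodic C^2 parametrization of the simple closed
   curve B; periodicity makes the curve C^2 at the closing point as well. *)
Definition C2_parametrization (R : realType) (B : set (R * R)) (L : R)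
    (x y : R -> R) : Prop :=
  [/\ 0 < L /\ (periodic x L /\ periodic y L),
      twice_continuously_differentiable x /\
      twice_continuously_differentiable y,
      forall t, (derive1 x t, derive1 y t) <> (0, 0),
      {in `[0, L[%R &, injective (fun t => (x t, y t))}
    & range (fun t => (x t, y t)) = B].

Definition C2_curve_of_positive_curvature (R : realType) (B : set (R * R)) :=
  exists (L : R) (x y : R -> R),
    C2_parametrization B L x y /\ forall t, 0 < curvature x y t.

(* Main.v *)
Require Import Defs.
From mathcomp Require Import all_boot all_order all_algebra.
From mathcomp Require Import all_classical all_reals all_analysis.
From mathcomp Require Import measurable_realfun.
From mathcomp Require Import ring lra zify.
Import Order.TTheory GRing.Theory Num.Theory.
Import numFieldNormedType.Exports.
Set Implicit Arguments.
Unset Strict Implicit.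
Unset Printing Implicit Defensive.
Local Open Scope ring_scope.
Local Open Scope classical_set_scope.

(* The discrepancy is reduced to the Poincare section {0} x [0,1).  If g(s) is
   the length of the chord of S on the line of slope alpha through (0, s), then
   up to O(1) the discrepancy is the Birkhoff sum, over the rotation by alpha, of
   the 1-periodization F of g, minus N * |S|; and |S| is the integral of g, by
   Fubini and a shear.  Convexity makes g concave on its support, positive
   curvature bounds it by the square root of the distance to the end points.

   Instead of Fourier series, F is compared with its averages
   M_w F(x) = (1/2w) int_{-w}^{w} F(x+u) du for widths w_j = |q_j alpha - p_j|,
   where q_j <= 16^j comes from Dirichlet's theorem.  For such w the Birkhoff sums
   of (H(x+w) - H(x-w)) telescope to sums over q_j terms, which Denjoy-Koksma
   bounds by the variation of H.  With h_w = F - M_w F one has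
   M_w' F - M_w F = M_w' h_w - M_w h_w', and concavity gives
   int |h_w| = O(w^{3/2}).  As w_j <= 16^-j, while w_j >= 32^-j for almost every
   alpha (Borel-Cantelli), the j-th difference has Birkhoff sums O(2^-j). *)

(** * Denjoy-Koksma inequality *)

(** Denjoy-Koksma by itself controls Birkhoff sums only at lengths [q]; uniformity in N comes from
    shifts by q alpha, since the difference of a sum of N terms and its shift is a difference of
    sums of q terms. An average M_w is a difference quotient of an antiderivative, so it has this
    shape, at the price of a division by w. The constants balance three exponents. The L1 error
    w^(3/2) is at most 64^-j for w <= 16^-j, and dividing it by a width of at least 32^-(j+1) leaves
    O(2^-j). Since 32 = 16^(5/4), the exponent 5/4 lies between 1, above which Borel-Cantelli
    applies, and 3/2, below which the series converges. The exponent 3/2 = 1 + 1/2 is where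
    curvature enters. At the two tangents of slope alpha the chord length behaves at worst like a
    square root, so near them the error is O(sqrt w) on edges of length O(w). Between the edges
    concavity fixes the sign of the error, and its zero integral bounds the middle by the edges. *)

Section DenjoyKoksma.
Variable R : realType.
Implicit Types (f H V : R -> R) (x y alpha : R).

Lemma periodic1z f x (k : int) : periodic f 1 -> f (x + k%:~R) = f x.
Proof.
move=> pf; case: k => n.
  by rewrite -pmulrn -(periodicn pf n x).
rewrite NegzE mulrNz -(periodicn pf n.+1 (x - _)).
by rewrite -pmulrn subrK.
Qed.

(** Multiplication by [p] permutes the residues mod [q], and the integer part of [i p / q] is
    absorbed by the period. *)
Lemma sum_coprime_rotation f x (p q : nat) : periodic f 1 -> (0 < q)%N ->
    coprime p q ->
  \sum_(i < q) f (x + (i * p)%:R / q%:R) = \sum_(i < q) f (x + i%:R / q%:R).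
Proof.
move=> pf q0 cpq.
pose h (i : 'I_q) : 'I_q := Ordinal (ltn_pmod (i * p) q0).
have hinj : injective h.
  move=> i j /(congr1 val)/= /eqP eij; apply/val_inj => /=.
  wlog lij : i j eij / (i <= j)%N.
    move=> W; case/orP: (leq_total i j) => l; first exact: W.
    by apply/esym/W => //; rewrite eq_sym.
  have : (q %| j * p - i * p)%N.
    by rewrite -eqn_mod_dvd ?leq_mul2r ?lij ?orbT// eq_sym.
  rewrite -mulnBl Gauss_dvdl; last by rewrite coprime_sym.
  have [|d0 /dvdn_leq] := posnP (j - i)%N; first by lia.
  by move=> /(_ d0); have := ltn_ord j; lia.
rewrite [RHS](reindex_inj hinj); apply: eq_bigr => i _ /=.
rewrite {1}(divn_eq (i * p) q) natrD mulrDl addrCA natrM mulfK ?pnatr_eq0 -?lt0n//.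
by rewrite addrC periodicn.
Qed.

Lemma sum_tiles V (v x : R) (q : nat) : (0 < q)%N ->
  (forall z, V (z + 1) = V z + v) ->
  \sum_(i < q) (V (x + i%:R / q%:R + q%:R^-1) - V (x + i%:R / q%:R)) = v.
Proof.
move=> q0 V1.
have -> : v = V (x + q%:R / q%:R) - V (x + 0%:R / q%:R).
  by rewrite divff ?pnatr_eq0 -?lt0n// mul0r addr0 V1 addrAC subrr add0r.
rewrite -(telescope_sumr (fun i : nat => V (x + i%:R / q%:R)) (leq0n q)).
rewrite big_mkord; apply: eq_bigr => i _.
by rewrite -natr1 mulrDl mul1r addrA.
Qed.

Definition birkhoff f alpha N x : R := \sum_(n < N) f (x + n%:R * alpha).

(** The sum of [N + q] terms is split in two ways; the right side has [q] terms whatever [N] is. *)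
Lemma birkhoff_shift f alpha N q x :
  birkhoff f alpha N (x + q%:R * alpha) - birkhoff f alpha N x =
  birkhoff f alpha q (x + N%:R * alpha) - birkhoff f alpha q x.
Proof.
have E m n : birkhoff f alpha (m + n) x =
    birkhoff f alpha m x + birkhoff f alpha n (x + m%:R * alpha).
  rewrite /birkhoff big_split_ord/=; congr (_ + _).
  by apply: eq_bigr => i _; rewrite natrD mulrDl addrA.
by have := E q N; rewrite addnC E; lra.
Qed.

Section control.
Variables (H V : R -> R) (v : R).
Hypotheses (H1 : periodic H 1) (V1 : forall z, V (z + 1) = V z + v).
Hypothesis HV : forall s t, s <= t -> `|H t - H s| <= V t - V s.
Variables (alpha : R) (p q : nat).
Hypotheses (q0 : (0 < q)%N) (cpq : coprime p q).
Let sigma := q%:R * alpha - p%:R.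
Hypothesis qs : q%:R * `|sigma| <= 1.

Let qR : (0 : R) < q%:R. Proof. by rewrite ltr0n. Qed.

(** [V] plays the part of a variation function of [H], with growth [v] over a period. Since
    [q * |sigma| <= 1], the orbit point of index [i] is displaced from the grid point [x + i p / q]
    by at most [1 / q], always to the side given by the sign of [sigma]. Each error is thus paid by
    one cell of the grid, and the cells tile a period. *)
Lemma denjoy_koksma_grid x :
  `|birkhoff H alpha q x - \sum_(i < q) H (x + i%:R / q%:R)| <= v.
Proof.
rewrite -(sum_coprime_rotation x H1 q0 cpq) -sumrB.
apply: le_trans (ler_norm_sum _ _ _) _.
pose W z := V (z + q%:R^-1) - V z.
have W1 : periodic W 1 by move=> z; rewrite /W addrAC !V1; ring.
have Ei (i : 'I_q) : x + i%:R * alpha = x + (i * p)%:R / q%:R + i%:R * sigma / q%:R.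
  by rewrite /sigma natrM; field; rewrite gt_eqF.
have isq (i : 'I_q) : `|i%:R * sigma / q%:R| <= q%:R^-1.
  rewrite normrM normfV (ger0_norm (ltW qR)) -[leRHS]mul1r ler_pM2r ?invr_gt0//.
  apply: le_trans qs; rewrite normrM ger0_norm// ler_wpM2r// ler_nat.
  exact/ltnW.
have [s0|s0] := leP 0 sigma.
- apply: (@le_trans _ _ (\sum_(i < q) W (x + (i * p)%:R / q%:R))); last first.
    by rewrite (sum_coprime_rotation x W1)// /W (sum_tiles _ q0 V1).
  apply: ler_sum => i _; rewrite Ei; set a := x + _; set d := _ / _.
  have d0 : 0 <= d by rewrite /d divr_ge0 ?mulr_ge0// ltW.
  have := isq i; rewrite -/d ger0_norm// => dq.
  have := HV (_ : a <= a + d); rewrite lerDl => /(_ d0) h.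
  have := HV (_ : a + d <= a + q%:R^-1); rewrite lerD2l => /(_ dq).
  rewrite /W; have := normr_ge0 (H (a + q%:R^-1) - H (a + d)); lra.
(* For negative [sigma] the cell lies to the left of the grid point, so the tiling starts at
   [x - 1 / q]. *)
- apply: (@le_trans _ _ (\sum_(i < q) W (x - q%:R^-1 + (i * p)%:R / q%:R))); last first.
    by rewrite (sum_coprime_rotation _ W1)// /W (sum_tiles _ q0 V1).
  apply: ler_sum => i _; rewrite Ei [x - _ + _]addrAC; set a := x + _; set d := _ / _.
  have d0 : d <= 0 by rewrite /d mulr_le0_ge0 ?mulr_ge0_le0 ?invr_ge0// ltW.
  have := isq i; rewrite -/d ler0_norm// => dq.
  have := HV (_ : a + d <= a); rewrite gerDl => /(_ d0) h.
  have := HV (_ : a - q%:R^-1 <= a + d); rewrite lerD2l lerNl => /(_ dq).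
  rewrite distrC in h; rewrite /W subrK.
  by have := normr_ge0 (H (a + d) - H (a - q%:R^-1)); lra.
Qed.

(** The grid sum has period [1 / q] in its base point, so [x] can be moved into [[y, y + 1 / q]],
    where corresponding points share a cell. *)
Lemma grid_sum_osc x y :
  `|\sum_(i < q) H (x + i%:R / q%:R) - \sum_(i < q) H (y + i%:R / q%:R)| <= v.
Proof.
pose k := Num.floor ((x - y) * q%:R).
pose r := (x - y) * q%:R - k%:~R.
have [r0 r1] : 0 <= r /\ r <= 1.
  have := floor_itv ((x - y) * q%:R); rewrite -/k /r intrD => /andP[]; lra.
pose T z := \sum_(i < q) H (z + i%:R / q%:R).
have T1 : periodic (fun z => T (z / q%:R)) 1.
  move=> z; rewrite /T.
  case: q q0 qR => // q' _ qR'.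
  rewrite big_ord_recr [RHS]big_ord_recl [LHS]addrC/=; congr (_ + _).
    rewrite -[RHS]H1; congr (H _); rewrite -natr1; field.
    by rewrite natr1 gt_eqF.
  apply: eq_bigr => i _; congr (H _); rewrite /bump/= add1n -!natr1; field.
  by rewrite natr1 gt_eqF.
have -> : \sum_(i < q) H (x + i%:R / q%:R) = T (y + r / q%:R).
  rewrite -/(T x) (_ : x = (y * q%:R + r + k%:~R) / q%:R); last first.
    by rewrite /r; field; rewrite gt_eqF.
  rewrite (periodic1z _ k T1); congr (T _).
  by field; rewrite gt_eqF.
rewrite /T -sumrB -(sum_tiles y q0 V1).
apply: le_trans (ler_norm_sum _ _ _) _; apply: ler_sum => i _.
rewrite addrAC; set a := y + _.
have d0 : a <= a + r / q%:R by rewrite lerDl divr_ge0// ltW.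
have dq : a + r / q%:R <= a + q%:R^-1.
  by rewrite lerD2l ler_pdivrMr// mulVf// gt_eqF.
have := HV d0; have := HV dq; have := normr_ge0 (H (a + q%:R^-1) - H (a + r / q%:R)); lra.
Qed.

Lemma denjoy_koksma x y :
  `|birkhoff H alpha q x - birkhoff H alpha q y| <= 3 * v.
Proof.
have := denjoy_koksma_grid x; have := denjoy_koksma_grid y.
have := grid_sum_osc x y; rewrite !ler_norml => /andP[? ?] /andP[? ?] /andP[? ?].
apply/andP; lra.
Qed.

(** Modulo 1 the shift by [sigma] is the shift by [q alpha]. The distance [2 * |sigma|] takes two
    such shifts, each costing [3 * v]; the symmetric form makes the sign of [sigma] irrelevant. *)
Lemma birkhoff_symm_diff N x :
  `|birkhoff H alpha N (x + `|sigma|) - birkhoff H alpha N (x - `|sigma|)| <= 6 * v.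
Proof.
have B1 : periodic (birkhoff H alpha N) 1.
  by move=> z; apply: eq_bigr => i _; rewrite addrAC H1.
have step z : `|birkhoff H alpha N (z + sigma) - birkhoff H alpha N z| <= 3 * v.
  rewrite (_ : z + sigma = z + q%:R * alpha + (- (p%:Z))%:~R); last first.
    by rewrite /sigma mulrNz addrA.
  by rewrite periodic1z// birkhoff_shift denjoy_koksma.
have two z : `|birkhoff H alpha N (z + sigma) - birkhoff H alpha N (z - sigma)| <= 6 * v.
  have := step z; have := step (z - sigma); rewrite subrK !ler_norml.
  move=> /andP[? ?] /andP[? ?]; apply/andP; lra.
have [s0|s0] := leP 0 sigma; first by rewrite (ger0_norm s0).
by rewrite (ltr0_norm s0) opprK distrC.
Qed.

End control.
End DenjoyKoksma.

(** * Birkhoff sums of smoothed functions *)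

Section BirkhoffBounded.
Variable R : realType.
Implicit Types (alpha : R).

Lemma dirichlet alpha (Q : nat) : 0 < alpha -> (0 < Q)%N ->
  exists q p : nat, [/\ (0 < q <= Q)%N, coprime p q &
    Q%:R * `|q%:R * alpha - p%:R| <= 1].
Proof.
move=> a0 Q0; have QR : (0 : R) < Q%:R by rewrite ltr0n.
(* Coprimality comes for free: dividing by the gcd keeps [q <= Q] and can only shrink the error. *)
suff [q [p [/andP[q0 qQ] qp]]] : exists q p : nat, (0 < q <= Q)%N /\
    Q%:R * `|q%:R * alpha - p%:R| <= 1.
  have g0 : (0 < gcdn p q)%N by rewrite gcdn_gt0 q0 orbT.
  exists (q %/ gcdn p q)%N, (p %/ gcdn p q)%N; split.
  - rewrite divn_gt0// dvdn_leq ?dvdn_gcdr//=.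
    exact: leq_trans (leq_div _ _) qQ.
  - rewrite /coprime -(eqn_pmul2r g0) mul1n muln_gcdl.
    by rewrite !divnK ?dvdn_gcdr ?dvdn_gcdl.
  - apply: le_trans qp; rewrite ler_wpM2l//.
    have -> : q%:R * alpha - p%:R = ((q %/ gcdn p q)%:R * alpha -
        (p %/ gcdn p q)%:R) * (gcdn p q)%:R.
      by rewrite mulrBl mulrAC -!natrM !divnK ?dvdn_gcdr ?dvdn_gcdl.
    rewrite normrM ler_peMr// ger0_norm// (_ : 1 = 1%:R)//.
    by rewrite ler_nat.
pose fr i : R := i%:R * alpha - (Num.floor (i%:R * alpha))%:~R.
have fr_itv i : 0 <= fr i < 1.
  by have := floor_itv (i%:R * alpha); rewrite intrD /fr => /andP[? ?]; apply/andP; lra.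
have ub i : (Num.truncn (Q%:R * fr i) < Q)%N.
  have /andP[f0 f1] := fr_itv i.
  rewrite truncn_lt_nat ?mulr_ge0//.
  by rewrite -[ltRHS]mulr1 ltr_pM2l.
pose h (i : 'I_Q.+1) : 'I_Q := Ordinal (ub i).
have /injectivePn[i [j]] : ~~ injectiveb h.
  apply/negP => /injectiveP /leq_card; rewrite !card_ord; lia.
wlog lij : i j / (i < j)%N.
  move=> W ij hij; case: (ltngtP i j) => l.
  - exact: (W i j).
  - by apply: (W j i) => //; rewrite eq_sym.
  - by move/eqP: ij; case; apply/val_inj.
move=> _ /(congr1 val)/= eij.
have fl : Num.floor (i%:R * alpha) <= Num.floor (j%:R * alpha).
  by apply: le_floor; rewrite ler_pM2r// ler_nat ltnW.
exists (j - i)%N, `|Num.floor (j%:R * alpha) - Num.floor (i%:R * alpha)|%N.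
split; first by have := ltn_ord j; lia.
rewrite natrB 1?ltnW// natr_absz (@ger0_norm int) ?subr_ge0// intrD mulrNz.
rewrite (_ : _ - _ = fr j - fr i); last by rewrite /fr; ring.
rewrite -[X in X * _](ger0_norm (ltW QR)) -normrM mulrBr.
have /andP[fi0 _] := fr_itv i; have /andP[fj0 _] := fr_itv j.
have /andP[] := truncn_itv (mulr_ge0 (ltW QR) fi0).
have /andP[] := truncn_itv (mulr_ge0 (ltW QR) fj0).
rewrite -eij -natr1 => ? ? ? ?; rewrite ler_norml; apply/andP; lra.
Qed.

(** All denominators up to [16 ^ j] are included, as it is not known which of them [dirichlet]
    returns at that level. *)
Definition diophantine alpha := exists j0 : nat, forall j : nat, (j0 <= j)%N ->
  forall q p : nat, (0 < q <= 16 ^ j)%N ->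
  32 ^- j <= `|q%:R * alpha - p%:R|.

Lemma is_derive_continuous (f df : R -> R) :
  (forall x, is_derive x (1 : R) f (df x)) -> continuous f.
Proof.
by move=> fd x; apply/differentiable_continuous/derivable1_diffP/ex_derive.
Qed.

Lemma is_derive_mull (k x : R) : is_derive x (1 : R) (fun y => k * y) k.
Proof. by apply: is_derive_eq; rewrite [_ *: _]mulr1. Qed.

Lemma is_derive_translate (f : R -> R) (d x c : R) :
  is_derive (x + c) (1 : R) f d -> is_derive x (1 : R) (fun y => f (y + c)) d.
Proof.
move=> fd; have := @is_derive1_comp R f (fun y => y + c) x d 1 fd.
by rewrite mulr1; apply; exact: (is_derive_shift x (1 : R) c).
Qed.

Lemma derive_bound_lipschitz (f df : R -> R) (K : R) :
  (forall x, is_derive x (1 : R) f (df x)) -> (forall x, `|df x| <= K) ->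
  forall s t, s <= t -> `|f t - f s| <= K * (t - s).
Proof.
move=> fd dK s t st.
have [c _ ->] := @MVT_segment R f df s t st (fun x _ => fd x)
  (continuous_subspaceT (is_derive_continuous fd)).
by rewrite normrM (ger0_norm (_ : 0 <= t - s)) ?subr_ge0// ler_wpM2r ?subr_ge0.
Qed.

(* An antiderivative of F - M_w F, when Phi' = F and Psi' = Phi. *)
Definition smoothing_error (Phi Psi : R -> R) (w x : R) : R :=
  Phi x - (Psi (x + w) - Psi (x - w)) / (2 * w).

(** Bounded variation on the circle through a dominating function. In the application [V] is an
    antiderivative of the absolute value of the derivative of [H], so that [v] is an L1 norm. *)
Definition control_on_circle (H V : R -> R) (v : R) :=
  (forall z, V (z + 1) = V z + v) /\
  (forall s t, s <= t -> `|H t - H s| <= V t - V s).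

Lemma control_ge0 (H V : R -> R) (v : R) : control_on_circle H V v -> 0 <= v.
Proof.
move=> [V1 HV]; have := HV 0 1 ler01; have := V1 0.
by have := normr_ge0 (H 1 - H 0); rewrite add0r; lra.
Qed.

Section Smoothing.
Variables (alpha lam K C : R) (F Phi Psi : R -> R).
Hypotheses (a0 : 0 < alpha) (aD : diophantine alpha).
Hypothesis dPhi : forall x, is_derive x (1 : R) Phi (F x).
Hypothesis dPsi : forall x, is_derive x (1 : R) Psi (Phi x).
Hypothesis Phi1 : forall x, Phi (x + 1) = Phi x + lam.
Hypothesis FK : forall x, `|F x| <= K.
Hypothesis err_var : forall j w, 0 < w -> w <= 16 ^- j ->
  exists V v, control_on_circle (smoothing_error Phi Psi w) V v /\ v <= C * 64 ^- j.
Hypothesis err_sup : forall j w x, 0 < w -> w <= 16 ^- j ->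
  `|F x - (Phi (x + w) - Phi (x - w)) / (2 * w)| <= C * 4 ^- j.

(** [Psi (y + 1) - Psi y] is [lam * y] plus a constant. The constant cancels in the symmetric
    difference, and the linear part yields the same increment [lam] as [Phi]. *)
Lemma smoothing_error_periodic w : w != 0 -> periodic (smoothing_error Phi Psi w) 1.
Proof.
move=> w0 x; pose D y := Psi (y + 1) - Psi y - lam * y.
have D0 y : is_derive y (1 : R) D 0.
  have d1 := is_derive_translate (dPsi (y + 1)).
  rewrite /D; apply: is_derive_eq.
  by rewrite Phi1 [_ *: _]mulr1; ring.
have Dc : forall a b, D a = D b by move=> a b; exact: is_derive_0_is_cst.
rewrite /smoothing_error Phi1 (addrAC x 1 w) (addrAC x 1).
have := Dc (x + w) (x - w); rewrite /D => e.
have -> : Psi (x + w + 1) = Psi (x - w + 1) + Psi (x + w) - Psi (x - w) + lam * (2 * w).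
  by lra.
by field.
Qed.

(* The Birkhoff sum of M_w F. *)
Definition smoothed_birkhoff N x w : R :=
  (birkhoff Phi alpha N (x + w) - birkhoff Phi alpha N (x - w)) / (2 * w).

Local Notation w_ qp := (`|qp.1%:R * alpha - qp.2%:R|).

Section one_orbit.
Variables (N : nat) (x : R).
Local Notation A := (smoothed_birkhoff N x).

(** Averages of two widths commute, so the terms carrying [Psi] shifted by both widths cancel. *)
Lemma smoothed_birkhoff_sub w w' : w != 0 -> w' != 0 ->
  A w' - A w = (birkhoff (smoothing_error Phi Psi w) alpha N (x + w') -
                birkhoff (smoothing_error Phi Psi w) alpha N (x - w')) / (2 * w')
             - (birkhoff (smoothing_error Phi Psi w') alpha N (x + w) -
                birkhoff (smoothing_error Phi Psi w') alpha N (x - w)) / (2 * w).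
Proof.
move=> w0 w0'; have E v y : birkhoff (smoothing_error Phi Psi v) alpha N y =
    birkhoff Phi alpha N y -
      (birkhoff Psi alpha N (y + v) - birkhoff Psi alpha N (y - v)) / (2 * v).
  rewrite /birkhoff -sumrB mulr_suml -sumrB; apply: eq_bigr => i _.
  by rewrite /smoothing_error (addrAC y v) (addrAC y (- v)).
rewrite !E /smoothed_birkhoff (addrAC x w w') (addrAC x w (- w')).
rewrite (addrAC x (- w) w') (addrAC x (- w) (- w')).
by field; apply/andP.
Qed.

(** The roles cross: the error of width [w] is shifted by [w'], hence reduced to [q'] terms, and
    conversely. Dividing [6 * C * 64 ^- j] by [2 * 32 ^- j.+1] gives the factor [96 = 6 * 32 / 2];
    for the other term [4] is generous. *)
Lemma smoothed_birkhoff_step j (qp qp' : nat * nat) :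
  (0 < qp.1 <= 16 ^ j)%N -> coprime qp.2 qp.1 -> 32 ^- j <= w_ qp <= 16 ^- j ->
  (0 < qp'.1 <= 16 ^ j.+1)%N -> coprime qp'.2 qp'.1 ->
  32 ^- j.+1 <= w_ qp' <= 16 ^- j.+1 ->
  `|A (w_ qp') - A (w_ qp)| <= 100 * C * 2 ^- j.
Proof.
case: qp qp' => q p [q' p'] /=; set w := w_ (q, p); set w' := w_ (q', p').
move=> /andP[q0 qj] cpq /andP[w32 w16] /andP[q0' qj'] cpq' /andP[w32' w16'].
have w0 : 0 < w by apply: lt_le_trans w32; rewrite invr_gt0 exprn_gt0.
have w0' : 0 < w' by apply: lt_le_trans w32'; rewrite invr_gt0 exprn_gt0.
rewrite smoothed_birkhoff_sub ?gt_eqF//.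
have qw i m (z : R) : (m <= 16 ^ i)%N -> z <= 16 ^- i -> m%:R * z <= 1.
  move=> mi zi; apply: (@le_trans _ _ ((16 : R) ^+ i * 16 ^- i)); last first.
    by rewrite mulfV// expf_neq0.
  apply: (@le_trans _ _ (m%:R * 16 ^- i)); first by rewrite ler_wpM2l.
  by rewrite ler_wpM2r// ?invr_ge0 ?exprn_ge0// -natrX ler_nat.
have [V [v [[V1 HV] vC]]] := err_var w0 w16.
have [V' [v' [[V1' HV'] vC']]] := err_var w0' w16'.
have v0 := control_ge0 (conj V1 HV); have v0' := control_ge0 (conj V1' HV').
have B1 := birkhoff_symm_diff (smoothing_error_periodic (lt0r_neq0 w0)) V1 HV
  q0' cpq' (qw _ _ _ qj' w16') N x.
have B2 := birkhoff_symm_diff (smoothing_error_periodic (lt0r_neq0 w0')) V1' HV'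
  q0 cpq (qw _ _ _ qj w16) N x.
have pj (k : R) i : 0 < k -> 0 < k ^- i by move=> k0; rewrite invr_gt0 exprn_gt0.
have E1 : `|(birkhoff (smoothing_error Phi Psi w) alpha N (x + w') -
    birkhoff (smoothing_error Phi Psi w) alpha N (x - w')) / (2 * w')| <= 96 * C * 2 ^- j.
  rewrite normrM normfV (ger0_norm (_ : 0 <= 2 * w')); last by rewrite mulr_ge0// ltW.
  rewrite ler_pdivrMr ?mulr_gt0//; apply: le_trans B1 _.
  apply: (@le_trans _ _ (6 * (C * 64 ^- j))); first by rewrite ler_wpM2l.
  apply: (@le_trans _ _ (96 * C * 2 ^- j * (2 * 32 ^- j.+1))); last first.
    have C0 : 0 <= C by have := le_trans v0 vC; rewrite pmulr_lge0// pj.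
    by rewrite !ler_wpM2l// ?mulr_ge0// ltW// pj.
  have -> : 64 ^- j = 2 ^- j * 32 ^- j :> R by rewrite -invfM -exprMn -natrM.
  by rewrite exprS; lra.
have E2 : `|(birkhoff (smoothing_error Phi Psi w') alpha N (x + w) -
    birkhoff (smoothing_error Phi Psi w') alpha N (x - w)) / (2 * w)| <= 4 * C * 2 ^- j.
  rewrite normrM normfV (ger0_norm (_ : 0 <= 2 * w)); last by rewrite mulr_ge0// ltW.
  rewrite ler_pdivrMr ?mulr_gt0//; apply: le_trans B2 _.
  apply: (@le_trans _ _ (6 * (C * 64 ^- j.+1))); first by rewrite ler_wpM2l.
  have C0 : 0 <= C by have := le_trans v0 vC; rewrite pmulr_lge0// pj.
  apply: (@le_trans _ _ (4 * C * 2 ^- j * (2 * 32 ^- j))); last first.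
    by rewrite !ler_wpM2l// ?mulr_ge0// ltW// pj.
  have -> : 64 ^- j.+1 = 2 ^- j * 32 ^- j / 64 :> R.
    by rewrite -invfM -exprMn -natrM exprS invfM mulrC.
  have : 0 <= C * (2 ^- j * 32 ^- j) by rewrite mulr_ge0// ltW// mulr_gt0 ?pj.
  lra.
apply: le_trans (ler_normB _ _) _; lra.
Qed.

(** [Phi - lam * y] is periodic and Lipschitz, so a linear function controls it. The bound degrades
    as the width shrinks, but it serves only at the level [j0]. *)
Lemma smoothed_birkhoff_lam (qp : nat * nat) :
  (0 < qp.1)%N -> coprime qp.2 qp.1 -> 0 < w_ qp -> qp.1%:R * w_ qp <= 1 ->
  `|A (w_ qp) - N%:R * lam| <= 6 * (K + `|lam|) / (2 * w_ qp).
Proof.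
case: qp => q p /=; set w := `|_| => q0 cpq w0 qw.
pose Q y := Phi y - lam * y.
have Q1 : periodic Q 1 by move=> y; rewrite /Q Phi1; ring.
have dQ y : is_derive y (1 : R) Q (F y - lam).
  have d := dPhi y; rewrite /Q; apply: is_derive_eq.
  by rewrite [_ *: _]mulr1.
have QV s t : s <= t -> `|Q t - Q s| <= (K + `|lam|) * t - (K + `|lam|) * s.
  rewrite -mulrBr; apply: derive_bound_lipschitz dQ _ s t => y.
  by apply: le_trans (ler_normB _ _) _; rewrite lerD2r.
have V1 z : (K + `|lam|) * (z + 1) = (K + `|lam|) * z + (K + `|lam|) by ring.
have B := @birkhoff_symm_diff R Q (fun z => (K + `|lam|) * z) _ Q1 V1 QV
  alpha p q q0 cpq qw N x.
have -> : A w - N%:R * lam =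
    (birkhoff Q alpha N (x + w) - birkhoff Q alpha N (x - w)) / (2 * w).
  have E y : birkhoff Q alpha N y = birkhoff Phi alpha N y -
      (N%:R * lam * y + lam * \sum_(n < N) n%:R * alpha).
    rewrite /birkhoff sumrB; congr (_ - _).
    rewrite -mulr_sumr big_split/= mulrDr sumr_const card_ord -mulr_natl.
    by congr (_ + _); ring.
  rewrite !E /smoothed_birkhoff; field; exact: lt0r_neq0.
rewrite normrM normfV (ger0_norm (_ : 0 <= 2 * w)); last by rewrite mulr_ge0// ltW.
by rewrite ler_pM2r// invr_gt0 mulr_gt0.
Qed.

(** Not uniform in [N], but for fixed [N] it tends to 0 with [j], which suffices to pass to the
    limit in bounds independent of [j]. *)
Lemma smoothed_birkhoff_cvg j w : 0 < w -> w <= 16 ^- j ->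
  `|birkhoff F alpha N x - A w| <= N%:R * (C * 4 ^- j).
Proof.
move=> w0 wj; rewrite /smoothed_birkhoff /birkhoff -sumrB mulr_suml -sumrB.
apply: le_trans (ler_norm_sum _ _ _) _.
have -> : N%:R * (C * 4 ^- j) = \sum_(n < N) (C * 4 ^- j).
  by rewrite sumr_const card_ord mulr_natl.
apply: ler_sum => i _.
by rewrite (addrAC x w) (addrAC x (- w)) err_sup.
Qed.

End one_orbit.

Lemma birkhoff_bounded :
  exists B, forall N x, `|birkhoff F alpha N x - N%:R * lam| <= B.
Proof.
have [j0 aj0] := aD.
have : forall j, exists qp : nat * nat, (j0 <= j)%N -> [/\ (0 < qp.1 <= 16 ^ j)%N,
    coprime qp.2 qp.1, 32 ^- j <= w_ qp <= 16 ^- j & 0 < w_ qp].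
  move=> j; have Q0 : (0 < 16 ^ j)%N by rewrite expn_gt0.
  have [q [p [qj cpq le]]] := dirichlet a0 Q0.
  exists (q, p) => jj0; have le32 := aj0 _ jj0 _ p qj; split => //=.
    rewrite le32/= -[leRHS]mul1r ler_pdivlMr ?exprn_gt0// mulrC.
    by rewrite natrX in le.
  by apply: lt_le_trans le32; rewrite invr_gt0 exprn_gt0.
move=> /choice[qp Hqp].
pose w j : R := w_ (qp j).
exists (200 * C + 6 * (K + `|lam|) / (2 * w j0)) => N x.
(* [100 * C * 2 ^- j] equals [200 * C * (2 ^- j - 2 ^- j.+1)], so the steps telescope. *)
have step n : `|smoothed_birkhoff N x (w (j0 + n)%N) - smoothed_birkhoff N x (w j0)|
    <= 200 * C * (2 ^- j0 - 2 ^- (j0 + n)).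
  elim: n => [|n IH]; first by rewrite addn0 !subrr normr0 mulr0.
  have [|? ? ? ?] := Hqp (j0 + n)%N; first by rewrite leq_addr.
  have [|? ? ? ?] := Hqp (j0 + n).+1; first by rewrite leqW ?leq_addr.
  have := @smoothed_birkhoff_step N x (j0 + n)%N (qp (j0 + n)%N) (qp (j0 + n).+1).
  do 6 (move=> /(_ ltac:(by [])));  rewrite -/(w _) -/(w _) addnS => st.
  have := ler_normD (smoothed_birkhoff N x (w (j0 + n).+1) - smoothed_birkhoff N x (w (j0 + n)%N))
    (smoothed_birkhoff N x (w (j0 + n)%N) - smoothed_birkhoff N x (w j0)).
  rewrite addrA subrK exprS invfM; lra.
have [q0j cpq0 /andP[_ w16] w0] := Hqp j0 (leqnn j0).
have base : `|smoothed_birkhoff N x (w j0) - N%:R * lam| <= 6 * (K + `|lam|) / (2 * w j0).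
  case/andP: q0j => q0 qj; apply: smoothed_birkhoff_lam => //.
  apply: (@le_trans _ _ ((16 ^ j0)%:R * 16 ^- j0)); last by rewrite natrX mulfV// expf_neq0.
  by rewrite ler_pM// ler_nat.
rewrite leNgt; apply/negP; set B := _ + _ => lt.
pose e := `|birkhoff F alpha N x - N%:R * lam| - B.
have e0 : 0 < e by rewrite subr_gt0.
(* The level is chosen after [N], so deep that [N * C * 4 ^- (j0 + n) < e]. *)
pose n := (Num.truncn (N%:R * C / e)).+1.
have C0 : 0 <= C.
  have := @err_sup 0%N 1 0 ltr01; rewrite !expr0 !invr1 (mulr1 C) => /(_ (lexx _)).
  exact: le_trans.
have nlt : N%:R * C / e < n%:R.
  by have /andP[] := truncn_itv (divr_ge0 (mulr_ge0 (ler0n R N) C0) (ltW e0)).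
have nle : (n%:R : R) <= 4 ^+ (j0 + n).
  rewrite -natrX ler_nat (leq_trans (ltnW (ltn_expl n (isT : 1 < 4)%N)))//.
  by rewrite leq_exp2l// leq_addl.
have [|? ? /andP[_ wn16] wn0] := Hqp (j0 + n)%N; first by rewrite leq_addr.
have cv := smoothed_birkhoff_cvg N x wn0 wn16.
have lte : N%:R * (C * 4 ^- (j0 + n)) < e.
  rewrite mulrA ltr_pdivrMr ?exprn_gt0// [ltRHS]mulrC -ltr_pdivrMr//.
  exact: lt_le_trans nlt nle.
have st : `|smoothed_birkhoff N x (w (j0 + n)%N) - smoothed_birkhoff N x (w j0)| <= 200 * C.
  apply: le_trans (step n) _; rewrite ler_piMr// ?mulr_ge0//.
  have h1 : 2 ^- j0 <= 1 :> R by rewrite invf_le1 ?exprn_gt0// exprn_ege1// ler1n.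
  have h2 : 0 <= 2 ^- (j0 + n) :> R by rewrite invr_ge0 exprn_ge0.
  lra.
have : `|birkhoff F alpha N x - N%:R * lam| < B + e.
  rewrite (_ : _ - _ = (birkhoff F alpha N x - smoothed_birkhoff N x (w (j0 + n)%N)) +
    ((smoothed_birkhoff N x (w (j0 + n)%N) - smoothed_birkhoff N x (w j0)) +
    (smoothed_birkhoff N x (w j0) - N%:R * lam))); last by ring.
  apply: le_lt_trans (ler_normD _ _) _; rewrite [ltLHS]addrC ler_ltD//.
    by apply: le_trans (ler_normD _ _) _; rewrite /B lerD.
  exact: le_lt_trans lte.
by rewrite /e addrCA subrr addr0 ltxx.
Qed.

End Smoothing.
End BirkhoffBounded.

(** * Diophantine slopes *)

Section AlmostAllDiophantine.
Variable R : realType.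
Local Notation mu := (@lebesgue_measure R).

(** The index [q] stands for the denominator [q.+1]; these numerators suffice for positive slopes
    below [M]. *)
Definition well_approximable (M j : nat) : set R :=
  \big[setU/set0]_(q < 16 ^ j) \big[setU/set0]_(p < M * q.+1 + 2)
    ball (p%:R / q.+1%:R : R) (32 ^- j / q.+1%:R).

Lemma measurable_well_approximable M j : measurable (well_approximable M j).
Proof.
by do 2 (apply: bigsetU_measurable => ? _); rewrite ball_itv; exact: measurable_itv.
Qed.

(** The number of numerators is at most [(M + 2) * q.+1], which cancels the denominator in the
    radius. Each of the [16 ^ j] denominators thus costs at most [2 * (M + 2) * 32 ^- j]. Writing
    the bound over [2 ^ j.+1] fits [epsilon_trick]. *)
Lemma lebesgue_measure_well_approximable M j :
  (mu (well_approximable M j) <= (4 * (M + 2)%:R / (2 ^ j.+1)%:R)%:E)%E.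
Proof.
pose r : R := 2 * (M + 2)%:R * 32 ^- j.
have pj : 0 < 32 ^- j :> R by rewrite invr_gt0 exprn_gt0.
apply: (@le_trans _ _ (\sum_(q < 16 ^ j) r%:E)%E); last first.
  rewrite sumEFin lee_fin sumr_const card_ord -[r *+ _]mulr_natl /r.
  have -> : 32 ^- j = 2 ^- j * 16 ^- j :> R by rewrite -invfM -exprMn -natrM.
  rewrite !natrX exprS le_eqVlt; apply/orP; left; apply/eqP.
  have h2 : 2 ^+ j != 0 :> R by rewrite expf_neq0.
  have h16 : 16 ^+ j != 0 :> R by rewrite expf_neq0.
  move: h2 h16; set u := 2 ^+ j; set v := 16 ^+ j => h2 h16.
  by field; rewrite h2 h16.
apply: le_trans; first apply: (@Boole_inequality _ R _ mu
    (fun q => \big[setU/set0]_(p < M * q.+1 + 2)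
    ball (p%:R / q.+1%:R : R) (32 ^- j / q.+1%:R))).
  by move=> i _; apply: bigsetU_measurable => ? _; rewrite ball_itv; exact: measurable_itv.
apply: lee_sum => q _.
apply: le_trans; first apply: (@Boole_inequality _ R _ mu
    (fun p => ball (p%:R / q.+1%:R : R) (32 ^- j / q.+1%:R))).
  by move=> i _; rewrite ball_itv; exact: measurable_itv.
rewrite (eq_bigr (fun=> (32 ^- j / q.+1%:R *+ 2)%:E)); last first.
  by move=> i _; apply: lebesgue_measure_ball; rewrite divr_ge0// ltW.
rewrite sumEFin lee_fin sumr_const card_ord -[leLHS]mulr_natl -[_ *+ 2]mulr_natl.
rewrite mulrA mulrA ler_pdivrMr// /r [leRHS]mulrAC mulrA.
apply: ler_wpM2r; first exact: ltW.
rewrite -!natrM ler_nat; nia.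
Qed.

(** Borel-Cantelli for each integer bound [M] on the slope, followed by a countable union over
    [M]. *)
Lemma ae_diophantine : {ae mu, forall alpha : R, 0 < alpha -> diophantine alpha}.
Proof.
have neg M : mu.-negligible (lim_sup_set (well_approximable M)).
  apply/negligibleP.
    apply: bigcap_measurable => // k _.
    by apply: bigcup_measurable => ? _; exact: measurable_well_approximable.
  apply: lim_sup_set_cvg0; first exact: measurable_well_approximable.
  apply: (@le_lt_trans _ _ (\sum_(i <oo) (0 + (4 * (M + 2)%:R / (2 ^ i.+1)%:R)%:E))%E).
    apply: lee_nneseries => // i _.
    by rewrite add0e lebesgue_measure_well_approximable.
  apply: le_lt_trans (epsilon_trick _ _ _) _ => //.
  by rewrite eseries0// add0e ltry.
apply: negligibleS (negligible_bigcup neg) => alpha /= /not_implyP[a0 aND].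
exists (Num.truncn alpha).+1 => // n _.
apply: contrapT => nE; apply: aND.
exists n => j nj q p /andP[q0 qj]; rewrite leNgt; apply/negP => lt.
apply: nE; exists j => //.
have aM : alpha < (Num.truncn alpha).+1%:R by have /andP[] := truncn_itv (ltW a0).
case: q q0 qj lt => // q _ qj lt.
rewrite /well_approximable -(bigcup_mkord _ (fun q : nat =>
  \big[setU/set0]_(p < (Num.truncn alpha).+1 * q.+1 + 2)
    ball (p%:R / q.+1%:R : R) (32 ^- j / q.+1%:R))).
exists q => //; rewrite -(bigcup_mkord _ (fun p : nat =>
  ball (p%:R / q.+1%:R : R) (32 ^- j / q.+1%:R))).
have qp : (0 : R) < q.+1%:R by [].
exists p => /=.
  have : (p%:R : R) < ((Num.truncn alpha).+1 * q.+1)%:R + 1.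
    have : `|q.+1%:R * alpha - p%:R| < 1.
      by apply: lt_le_trans lt _; rewrite invf_le1 ?exprn_gt0// exprn_ege1// ler1n.
    have : q.+1%:R * alpha < (Num.truncn alpha).+1%:R * q.+1%:R.
      by rewrite mulrC ltr_pM2r.
    by rewrite natrM ltr_norml => ? /andP[? ?]; lra.
  by rewrite -(natrD _ _ 1) ltr_nat; lia.
rewrite /ball/= distrC (_ : alpha - _ = (q.+1%:R * alpha - p%:R) / q.+1%:R); last first.
  by field; rewrite -natr1 in qp; rewrite gt_eqF.
by rewrite normrM normfV (ger0_norm (ltW qp)) ltr_pM2r ?invr_gt0.
Qed.

Lemma diophantine_irrational (alpha : R) : 0 < alpha -> diophantine alpha ->
  irrational alpha.
Proof.
move=> a0 [j0 aD] /rationalP[a [b ab]].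
have b0 : (0 < b)%N by case: b ab => // ab; move: a0; rewrite ab invr0 mulr0 ltxx.
have az : 0 <= a.
  move: a0; rewrite ab pmulr_lgt0 ?invr_gt0 ?ltr0n// ltr0z; exact: ltW.
have := aD (j0 + b)%N (leq_addr _ _) b `|a|%N.
rewrite b0 /= (leq_trans (leq_addl j0 b) (ltnW (ltn_expl _ _)))// => /(_ erefl).
rewrite natr_absz (ger0_norm az) ab mulrC divfK ?pnatr_eq0 -?lt0n// subrr normr0.
by rewrite leNgt invr_gt0 exprn_gt0.
Qed.

End AlmostAllDiophantine.

(** * Concave functions with square root behaviour *)

Section ConcaveBump.
Variable R : realType.
Implicit Types (f g df dg : R -> R).
Local Notation mu := (@lebesgue_measure R).

(** An integral from [- n] serves only points to the right of [- n]; subtracting its value at 0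
    makes it independent of [n], so the pieces glue. *)
Lemma exists_antiderivative f : continuous f ->
  exists F : R -> R, forall x, is_derive x (1 : R) F (f x).
Proof.
move=> cf.
have intf (u v : R) : mu.-integrable `[u, v] (EFin \o f).
  apply: continuous_compact_integrable; first exact: segment_compact.
  exact: continuous_subspaceT.
pose I (n : nat) x : R := \int[mu]_(t in `[- n%:R, x]) f t.
pose N (x : R) := (Num.truncn `|x|).+1.
exists (fun x => I (N x) x - I (N x) 0) => x.
have NP y : `|y| < (N y)%:R by have /andP[] := truncn_itv (normr_ge0 y).
have IE m n y : (n <= m)%N -> - n%:R <= y -> I m y = I m (- n%:R) + I n y.
  move=> nm ny; rewrite addrC; apply/eqP; rewrite -subr_eq; apply/eqP.
  rewrite [LHS]Rintegral_itvB//=; rewrite ?bnd_simp//.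
    rewrite Rintegral_itv_obnd_cbnd//.
    by apply: integrableS (intf (- n%:R) y) => //; apply: subset_itvr; rewrite bnd_simp.
  by rewrite lerN2 ler_nat.
have sh m y : (N y <= m)%N -> I (N y) y - I (N y) 0 = I m y - I m 0.
  move=> Nm; rewrite (IE m (N y) y)//; last first.
    by have := NP y; rewrite ltr_norml => /andP[/ltW].
  by rewrite (IE m (N y) 0)// ?oppr_le0//; ring.
pose m := (N x).+1.
have : is_derive x (1 : R) (fun y => I m y - I m 0) (f x).
  have xm : x < m%:R.
    by apply: lt_trans (le_lt_trans (ler_norm x) (NP x)) _; rewrite ltr_nat.
  have mx : - m%:R < x.
    by have := NP x; rewrite ltr_norml /m -natr1 => /andP[? _]; lra.
  have [dI I'] := continuous_FTC1_closed xm (intf _ _) mx (cf x).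
  have dIm : is_derive x (1 : R) (I m) (f x).
    exact: (DeriveDef dI (etrans (esym (derive1E (I m) x)) I')).
  by apply: is_derive_eq; rewrite subr0.
apply: near_eq_is_derive; near=> y; apply/esym/sh.
rewrite /m /N ltnS -ltnS -(ltr_nat R) -[ltRHS]natr1.
have : (Num.truncn `|y|)%:R <= `|y| by rewrite truncn_le.
have := NP x; rewrite /N.
have : `|y| <= `|x| + 1.
  rewrite -lerBlDl; apply: le_trans (lerB_dist _ _) _.
  rewrite distrC; near: y.
  exact: (@cvgr_dist_le _ _ _ _ _ id x cvg_id 1 ltr01).
by lra.
Unshelve. all: by end_near. Qed.

(** Monotonicity of integrals phrased with antiderivatives, through the mean value theorem; the
    estimates below then need no integrability conditions. *)
Lemma ler_increment f df g dg s t :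
  (forall x, is_derive x (1 : R) f (df x)) ->
  (forall x, is_derive x (1 : R) g (dg x)) -> s <= t ->
  (forall x, s < x < t -> df x <= dg x) -> f t - f s <= g t - g s.
Proof.
move=> fd gd; rewrite le_eqVlt => /predU1P[->|st] le; first by rewrite !subrr.
have hd x : is_derive x (1 : R) (fun x => g x - f x) (dg x - df x).
  by have := fd x; have := gd x => ? ?; apply: is_derive_eq.
have [c cst] := MVT st (fun x _ => hd x)
  (continuous_subspaceT (is_derive_continuous hd)).
rewrite in_itv/= in cst; have := le c cst => dle e.
have : 0 <= (dg c - df c) * (t - s) by rewrite mulr_ge0 ?subr_ge0// ltW.
by rewrite -e; lra.
Qed.

(** The model of the chord length as a function of the level of the line. Concavity is asked on the
    open support only, as the extension by zero need not be concave across its ends. *)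
Definition concave_bump g (a b c : R) := [/\ a <= b /\ 0 <= c,
  forall x, 0 <= g x,
  forall x, x <= a \/ b <= x -> g x = 0,
  forall x y t, a < x < b -> a < y < b -> 0 <= t <= 1 ->
    t * g x + (1 - t) * g y <= g (t * x + (1 - t) * y)
  & forall x d, 0 <= d -> x - a <= d \/ b - x <= d -> g x <= c * Num.sqrt d].

Lemma concave_bump_opp g a b c : concave_bump g a b c ->
  concave_bump (fun x => g (- x)) (- b) (- a) c.
Proof.
move=> [[ab c0] g0 gout gconc gsqrt]; split => //.
- by rewrite lerN2.
- by move=> x [xb|ax]; apply: gout; [right|left]; lra.
- move=> x y t /andP[? ?] /andP[? ?] t01.
  have -> : - (t * x + (1 - t) * y) = t * (- x) + (1 - t) * (- y) by ring.
  by apply: gconc => //; apply/andP; lra.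
- by move=> x d d0 [h|h]; apply: gsqrt => //; [right|left]; lra.
Qed.

Lemma sqrtr_le (x d : R) : 0 <= d -> x <= d ^+ 2 -> Num.sqrt x <= d.
Proof. by move=> d0 xd; rewrite -(ger0_norm d0) -sqrtr_sqr ler_wsqrtr. Qed.

Lemma sqrtr_double_le (d : R) : 0 <= d -> Num.sqrt (2 * d) <= 2 * Num.sqrt d.
Proof.
move=> d0; apply: sqrtr_le; first by rewrite mulr_ge0 ?sqrtr_ge0.
by rewrite exprMn sqr_sqrtr//; lra.
Qed.

(** By concavity, increments over a fixed length [d] decrease to the right, so this one is at most
    the increment from a point [a'] near [a], where the square root bound applies. Reflection gives
    the opposite bound. *)
Lemma concave_bump_increment g a b c x y : concave_bump g a b c -> x <= y ->
  g y - g x <= 2 * c * Num.sqrt (y - x).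
Proof.
move=> [[ab c0] g0 gout gconc gsqrt] xy; set d := y - x.
have d0 : 0 <= d by rewrite subr_ge0.
have sd := sqrtr_ge0 d.
have [yb|yb] := leP b y.
  by rewrite gout; [rewrite sub0r (@le_trans _ _ 0)// ?oppr_le0// !mulr_ge0|right].
have [xa|xa] := leP x a.
  apply: (@le_trans _ _ (g y)); first by rewrite gerBl.
  apply: (@le_trans _ _ (c * Num.sqrt d)).
    by apply: gsqrt => //; left; rewrite /d; lra.
  by rewrite ler_wpM2r//; lra.
have [d00|dn0] := eqVneq d 0.
  have -> : y = x by move: d00; rewrite /d; lra.
  by rewrite subrr !mulr_ge0.
have dp : 0 < d by rewrite lt_neqAle eq_sym dn0.
(* The midpoint keeps [a'] strictly between [a] and [x], where concavity is available; [a' <= a + d]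
   gives [a' + d - a <= 2 * d]. *)
pose a' := Num.min ((a + x) / 2) (a + d).
have [h1 h2 h3] : [/\ a < a', a' < x & a' <= a + d].
  by rewrite /a' lt_min gt_min ge_min lexx orbT; split => //; [apply/andP|apply/orP; left]; lra.
pose t := (x - a') / (y - a').
have ya' : 0 < y - a' by lra.
have t01 : 0 <= t <= 1.
  by rewrite /t ler_pdivrMr// ler_pdivlMr// mul0r; apply/andP; lra.
have t01' : 0 <= 1 - t <= 1 by move: t01 => /andP[? ?]; apply/andP; lra.
have tE : t * (y - a') = x - a' by rewrite divfK// gt_eqF.
have a'i : a < a' < b by apply/andP; lra.
have yi : a < y < b by apply/andP; lra.
have := gconc y a' t yi a'i t01; have := gconc y a' (1 - t) yi a'i t01'.
have -> : (1 - t) * y + (1 - (1 - t)) * a' = a' + d by rewrite /d; lra.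
have -> : t * y + (1 - t) * a' = x by lra.
have : g (a' + d) <= c * Num.sqrt (2 * d) by apply: gsqrt; [lra|left; lra].
have : c * Num.sqrt (2 * d) <= c * (2 * Num.sqrt d).
  by rewrite ler_wpM2l// sqrtr_double_le.
have := g0 a'; lra.
Qed.

Lemma concave_bump_hoelder g a b c x y : concave_bump g a b c ->
  `|g x - g y| <= 2 * c * Num.sqrt `|x - y|.
Proof.
move=> gb; wlog xy : x y / x <= y.
  by move=> W; case/orP: (le_total x y) => h; [|rewrite distrC (distrC x)]; exact: W.
rewrite distrC [`|x - y|]distrC [in leRHS]ger0_norm ?subr_ge0// ler_norml.
rewrite (concave_bump_increment gb xy) andbT lerNl opprB.
have := @concave_bump_increment _ _ _ _ (- y) (- x) (concave_bump_opp gb).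
by rewrite lerN2 !opprK => /(_ xy); rewrite [- x + y]addrC.
Qed.

Lemma concave_bump_continuous g a b c : concave_bump g a b c -> continuous g.
Proof.
move=> gb x; apply/cvgrPdist_le => e e0.
have c0 : 0 <= c by case: gb => -[].
have k0 : 0 < e / (2 * c + 1) by rewrite divr_gt0//; lra.
near=> y; apply: le_trans (concave_bump_hoelder x y gb) _.
apply: (@le_trans _ _ (2 * c * (e / (2 * c + 1)))).
  rewrite ler_wpM2l ?mulr_ge0//; apply: sqrtr_le; first exact: ltW.
  by near: y; apply: (@cvgr_dist_le _ _ _ _ _ id x cvg_id); rewrite exprn_gt0.
rewrite mulrA ler_pdivrMr; last by lra.
by rewrite mulrC ler_wpM2l; lra.
Unshelve. all: by end_near. Qed.

(** * L1 norm of the smoothing error of a concave bump *)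

Section variation.
Variables (g Phi Psi V : R -> R) (a b c w : R).
Hypotheses (gb : concave_bump g a b c) (w0 : 0 < w).
Hypothesis dPhi : forall x, is_derive x (1 : R) Phi (g x).
Hypothesis dPsi : forall x, is_derive x (1 : R) Psi (Phi x).
Let h x := g x - (Phi (x + w) - Phi (x - w)) / (2 * w).
Hypothesis dV : forall x, is_derive x (1 : R) V `|h x|.

Let d_cst x : is_derive x (1 : R) (fun=> 0 : R) 0.
Proof. exact: is_derive_cst. Qed.

Lemma smoothing_error_sup x : `|h x| <= 2 * c * Num.sqrt w.
Proof.
have w0' := w0; have lt : x - w < x + w by lra.
have [z] := MVT lt (fun x _ => dPhi x)
  (continuous_subspaceT (is_derive_continuous dPhi)).
rewrite in_itv/= => /andP[z1 z2] e.
rewrite /h e (_ : g z * _ / _ = g z); last by field; exact: lt0r_neq0.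
apply: le_trans (concave_bump_hoelder x z gb) _.
have c0 : 0 <= c by case: gb => -[].
rewrite ler_wpM2l ?mulr_ge0// ler_sqrt; last exact: ltW.
by rewrite ler_norml; apply/andP; lra.
Qed.

Lemma is_derive_smoothing_error x :
  is_derive x (1 : R) (smoothing_error Phi Psi w) (h x).
Proof.
have d1 := is_derive_translate (dPsi (x + w)).
have d2 := is_derive_translate (dPsi (x - w)).
have d0 := dPhi x.
rewrite /smoothing_error.
have -> : (fun y => Phi y - (Psi (y + w) - Psi (y - w)) / (2 * w)) =
  (fun y => Phi y - (2 * w)^-1 * (Psi (y + w) - Psi (y - w))).
  by apply/funext => y; rewrite mulrC.
by apply: is_derive_eq; rewrite /h [_ / _]mulrC.
Qed.

(** Midpoint concavity for the pairs [x + u], [x - u], integrated over [0 < u < w]; the window stays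
    inside the support. *)
Lemma smoothing_error_ge0 x : a + w < x < b - w -> 0 <= h x.
Proof.
have w0' := w0; move=> /andP[xa xb]; rewrite /h subr_ge0 ler_pdivrMr ?mulr_gt0//.
have dP u : is_derive u (1 : R) (fun u => Phi (u + x)) (g (u + x)).
  exact: is_derive_translate.
have dM u : is_derive u (1 : R) (fun u => - Phi (x - u)) (g (x - u)).
  have := @is_derive1_comp R Phi (fun u => x - u) u (g (x - u)) (- 1) (dPhi _).
  have dl : is_derive u (1 : R) (fun u => x - u) (- 1).
    by apply: is_derive_eq; rewrite add0r mul1r.
  move=> /(_ dl) hh.
  have hh' : is_derive u (1 : R) (fun u => Phi (x - u)) (g (x - u) * - 1) by [].
  by apply: is_derive_eq; rewrite mulrN1 opprK.
have dS u : is_derive u (1 : R) (fun u => Phi (u + x) + - Phi (x - u))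
    (g (u + x) + g (x - u)).
  exact: (is_deriveD (dP u) (dM u)).
have := @ler_increment _ _ _ _ 0 w dS (is_derive_mull (2 * g x)) (ltW w0).
rewrite add0r (subr0 x) (addrC w) => hh.
suff /hh : forall u, 0 < u < w -> g (u + x) + g (x - u) <= 2 * g x by lra.
move=> u /andP[u0 uw]; case: gb => _ _ _ gconc _.
have i1 : a < u + x < b by apply/andP; lra.
have i2 : a < x - u < b by apply/andP; lra.
have i3 : 0 <= (2^-1 : R) <= 1 by apply/andP; lra.
have := gconc (u + x) (x - u) 2^-1 i1 i2 i3.
have -> : 2^-1 * (u + x) + (1 - 2^-1) * (x - u) = x by lra.
by lra.
Qed.

Lemma antiderivative_left x y : x <= a -> y <= a -> Phi x = Phi y.
Proof.
wlog xy : x y / x <= y.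
  by move=> W xa ya; case/orP: (le_total x y) => ?; [|apply/esym]; exact: W.
move=> xa ya; have gz z : x < z < y -> g z = 0.
  by move=> /andP[_ zy]; case: gb => _ _ gout _ _; apply: gout; left; lra.
have := @ler_increment _ _ _ _ x y dPhi d_cst xy.
have := @ler_increment _ _ _ _ x y d_cst dPhi xy.
rewrite subrr => h1 h2.
have : 0 <= Phi y - Phi x by apply: h1 => z /gz ->.
have : Phi y - Phi x <= 0 by apply: h2 => z /gz ->.
by lra.
Qed.

Lemma antiderivative_right x y : b <= x -> b <= y -> Phi x = Phi y.
Proof.
wlog xy : x y / x <= y.
  by move=> W xa ya; case/orP: (le_total x y) => ?; [|apply/esym]; exact: W.
move=> xa ya; have gz z : x < z < y -> g z = 0.
  by move=> /andP[zx _]; case: gb => _ _ gout _ _; apply: gout; right; lra.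
have := @ler_increment _ _ _ _ x y dPhi d_cst xy.
have := @ler_increment _ _ _ _ x y d_cst dPhi xy.
rewrite subrr => h1 h2.
have : 0 <= Phi y - Phi x by apply: h1 => z /gz ->.
have : Phi y - Phi x <= 0 by apply: h2 => z /gz ->.
by lra.
Qed.

Let second_diff x k : (forall y, x - w < y < x + w -> Phi y = k) ->
  smoothing_error Phi Psi w x = Phi x - k.
Proof.
have w0' := w0; move=> Pk; congr (_ - _).
have lt : x - w <= x + w by lra.
have h1 := @ler_increment _ _ _ _ (x - w) (x + w) dPsi (is_derive_mull k) lt.
have h2 := @ler_increment _ _ _ _ (x - w) (x + w) (is_derive_mull k) dPsi lt.
have le1 : Psi (x + w) - Psi (x - w) <= k * (x + w) - k * (x - w).
  by apply: h1 => y yi; rewrite Pk.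
have le2 : k * (x + w) - k * (x - w) <= Psi (x + w) - Psi (x - w).
  by apply: h2 => y yi; rewrite Pk.
have -> : Psi (x + w) - Psi (x - w) = k * (2 * w) by lra.
by rewrite mulfK// mulf_neq0// lt0r_neq0.
Qed.

(** Together with its counterpart on the right, this says that [h] has integral zero. *)
Lemma smoothing_error_left x : x <= a - w -> smoothing_error Phi Psi w x = 0.
Proof.
have w0' := w0; move=> xa; rewrite (@second_diff _ (Phi x)) ?subrr// => y /andP[_ yx].
by apply: antiderivative_left; lra.
Qed.

Lemma smoothing_error_right x : b + w <= x -> smoothing_error Phi Psi w x = 0.
Proof.
have w0' := w0; move=> xa; rewrite (@second_diff _ (Phi x)) ?subrr// => y /andP[yx _].
by apply: antiderivative_right; lra.
Qed.

Lemma variation_outside x y : x <= y -> y <= a - w \/ b + w <= x -> V y = V x.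
Proof.
have w0' := w0; move=> xy yx.
have hz z : x < z < y -> h z = 0.
  move=> /andP[xz zy]; rewrite /h; case: gb => _ _ gout _ _.
  rewrite gout; last by case: yx => ?; [left|right]; lra.
  have -> : Phi (z + w) = Phi (z - w).
    by case: yx => ?; [apply: antiderivative_left|apply: antiderivative_right]; lra.
  by rewrite subrr mul0r subrr.
have h1 := @ler_increment _ _ _ _ x y dV d_cst xy.
have h2 := @ler_increment _ _ _ _ x y d_cst dV xy.
have : V y - V x <= 0 - 0 by apply: h1 => z /hz ->; rewrite normr0.
have : 0 - 0 <= V y - V x by apply: h2 => z /hz ->; rewrite normr0.
by lra.
Qed.

Lemma variation_lipschitz x y : x <= y -> V y - V x <= 2 * c * Num.sqrt w * (y - x).
Proof.
move=> xy; have h1 := @ler_increment _ _ _ _ x y dV (is_derive_mull (2 * c * Num.sqrt w)) xy.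
rewrite mulrBr; apply: h1 => z _; exact: smoothing_error_sup.
Qed.

Lemma smoothing_error_control x y : x <= y ->
  `|smoothing_error Phi Psi w y - smoothing_error Phi Psi w x| <= V y - V x.
Proof.
move=> xy; rewrite ler_norml; apply/andP; split; last first.
  apply: (ler_increment is_derive_smoothing_error dV xy) => z _; exact: ler_norm.
have dN z : is_derive z (1 : R) (fun z => - V z) (- `|h z|).
  by have := dV z => ?; apply: is_derive_eq.
have := ler_increment dN is_derive_smoothing_error xy.
rewrite [- V y - _]addrC opprK => le; rewrite opprB; apply: le => z _.
by rewrite lerNl -normrN ler_norm.
Qed.

(* The error is nonnegative on the middle part, so its integral there equals
   minus the one over the two edges, the total integral being zero. *)
Lemma variation_le : V (b + w) - V (a - w) <= 16 * c * (w * Num.sqrt w).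
Proof.
have w0' := w0; have [[ab c0] _ _ _ _] := gb.
have cw : 0 <= c * Num.sqrt w * w by rewrite !mulr_ge0 ?sqrtr_ge0// ltW.
(* When the edges overlap, the sup bound over a total length below [4 * w] suffices. *)
have [lt|le] := leP (b - w) (a + w).
  have le : a - w <= b + w by lra.
  have := variation_lipschitz le.
  have : c * Num.sqrt w * (b + w - (a - w)) <= c * Num.sqrt w * (4 * w).
    by rewrite ler_wpM2l ?mulr_ge0 ?sqrtr_ge0//; lra.
  by lra.
(* Each edge has length [2 * w] and contributes at most [4 * c * (w * Num.sqrt w)]; the middle
   contributes at most as much as the bounds of both edges together, hence [16]. *)
have h1 : a - w <= a + w by lra.
have h2 : b - w <= b + w by lra.
have l1 := variation_lipschitz h1; have l2 := variation_lipschitz h2.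
have c1 := smoothing_error_control h1; have c2 := smoothing_error_control h2.
rewrite (@smoothing_error_left (a - w)) ?subr0// in c1.
rewrite (@smoothing_error_right (b + w)) ?sub0r ?normrN// in c2.
have mid := ler_increment dV is_derive_smoothing_error (ltW le).
have : V (b - w) - V (a + w) <= smoothing_error Phi Psi w (b - w) -
    smoothing_error Phi Psi w (a + w).
  by apply: mid => z zi; rewrite ger0_norm// smoothing_error_ge0.
move: c1 c2; rewrite !ler_norml => /andP[? ?] /andP[? ?].
by lra.
Qed.

End variation.
End ConcaveBump.

(** * Periodization *)

Section Periodization.
Variable R : realType.
Implicit Types (f df F : R -> R).

Lemma frac_part_itv (x : R) : 0 <= frac_part x < 1.
Proof.
by have := floor_itv x; rewrite intrD /frac_part => /andP[? ?]; apply/andP; lra.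
Qed.

Lemma frac_partK (x : R) : frac_part x + (Num.floor x)%:~R = x.
Proof. by rewrite /frac_part subrK. Qed.

Lemma frac_part_periodic : periodic (@frac_part R) 1.
Proof.
move=> x; rewrite /frac_part -[X in Num.floor (_ + X)]/(1%:~R).
by rewrite floorDrz ?intr_int// intrKfloor intrD; ring.
Qed.

Lemma antiderivative_periodic F f : periodic f 1 ->
  (forall x, is_derive x (1 : R) F (f x)) ->
  forall z, F (z + 1) = F z + (F 1 - F 0).
Proof.
move=> f1 dF z; pose D x := F (x + 1) - F x.
have dD x : is_derive x (1 : R) D 0.
  have -> : 0 = f (x + 1) - f x by rewrite f1 subrr.
  exact: (is_deriveB (is_derive_translate (dF (x + 1))) (dF x)).
by have := is_derive_0_is_cst z 0 dD; rewrite /D add0r; lra.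
Qed.

Variable m : nat.

(* Truncated periodization: it agrees with the sum over all integer translates
   only for x near [0, 1] and f supported in [3 - m, m - 3]. *)
Definition periodize f x : R := \sum_(k < m.*2) f (x + (k%:R - m%:R)).

Lemma periodize_shift f x :
  periodize f (x + 1) - periodize f x = f (x + m%:R) - f (x - m%:R).
Proof.
rewrite /periodize -sumrB.
rewrite -(big_mkord xpredT (fun k => f (x + 1 + (k%:R - m%:R)) - f (x + (k%:R - m%:R)))).
rewrite (eq_bigr (fun k => f (x + (k.+1%:R - m%:R)) - f (x + (k%:R - m%:R)))).
  rewrite (telescope_sumr (fun k => f (x + (k%:R - m%:R))))// sub0r.
  by rewrite -addnn natrD addrK.
by move=> k _; congr (f _ - _); rewrite -natr1; ring.
Qed.

Lemma is_derive_periodize f df x : (forall x, is_derive x (1 : R) f (df x)) ->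
  is_derive x (1 : R) (periodize f) (periodize df x).
Proof.
move=> fd; have := @is_derive_sum R R R m.*2
  (fun k y => f (y + (k%:R - m%:R))) x 1 (fun k => df (x + (k%:R - m%:R))).
have -> : \sum_(i < m.*2) (fun y => f (y + (i%:R - m%:R))) = periodize f.
  by apply/funext => y; rewrite /periodize fct_sumE.
by apply=> i; exact: is_derive_translate.
Qed.

Lemma periodize_continuous f : continuous f -> continuous (periodize f).
Proof.
move=> cf x; rewrite /periodize.
have -> : (fun y => \sum_(k < m.*2) f (y + (k%:R - m%:R))) =
    \sum_(i < m.*2) (fun y => f (y + (i%:R - m%:R))).
  by apply/funext => y; rewrite fct_sumE.
apply: (@big_ind _ (fun u : R -> R => {for x, continuous u})).
- exact: cvg_cst.
- by move=> u v cu cv; exact: continuousD.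
move=> i _; apply: continuous_comp; last exact: cf.
by apply: continuousD; [exact: cvg_id|exact: cvg_cst].
Qed.

Lemma continuous_translate f k : continuous f -> continuous (fun x : R => f (x + k)).
Proof.
move=> cf x; apply: continuous_comp; last exact: cf.
by apply: continuousD; [exact: cvg_id|exact: cvg_cst].
Qed.

Lemma continuous_norm_error f F w : continuous f -> continuous F ->
  continuous (fun x => `|f x - (F (x + w) - F (x - w)) / (2 * w)|).
Proof.
move=> cf cF x.
apply: (@continuous_comp _ _ _ (fun x => f x - (F (x + w) - F (x - w)) / (2 * w))
  Num.norm); last exact: norm_continuous.
apply: (@continuousB _ R R f (fun x => (F (x + w) - F (x - w)) / (2 * w))).
  exact: cf.
apply: (@continuousM _ R (fun x => F (x + w) - F (x - w)) (fun=> (2 * w)^-1)).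
  by apply: (@continuousB _ R R (fun x => F (x + w)) (fun x => F (x - w)));
    exact: continuous_translate.
exact: cvg_cst.
Qed.

Section bump.
Variables (g Phi : R -> R) (a b c : R).
Hypotheses (gb : concave_bump g a b c) (am : 3 - m%:R <= a) (bm : b <= m%:R - 3).
Hypothesis dPhi : forall x, is_derive x (1 : R) Phi (g x).

Let gper x := periodize g (frac_part x).

Lemma periodize_step x : -1 <= x <= 1 -> periodize g (x + 1) = periodize g x.
Proof.
have am' := am; have bm' := bm => /andP[x1 x2].
apply/eqP; rewrite -subr_eq0 periodize_shift; case: gb => _ _ gout _ _.
by rewrite !gout ?subrr//; [left|right]; lra.
Qed.

(** The range [[-1, 2]] contains [x + w] and [x - w] for all [x] in [[0, 1]] and [0 < w <= 1]. *)
Lemma periodize_frac x : -1 <= x <= 2 -> periodize g (frac_part x) = periodize g x.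
Proof.
move=> /andP[x1 x2]; rewrite -{2}(frac_partK x).
have /andP[f0 f1] := frac_part_itv x.
have : Num.floor x \in [:: -1; 0; 1; 2].
  have : (-1) <= Num.floor x by rewrite floor_ge_int.
  have : Num.floor x < 3 by rewrite floor_lt_int; lra.
  by move: (Num.floor x) => [[|[|[|//]]]|[|]].
rewrite !inE => /or4P[] /eqP e; rewrite e ?addr0//.
- have -> : (-1)%:~R = -1 :> R by [].
  by rewrite -[RHS]periodize_step ?subrK//; apply/andP; lra.
- by have -> : 1%:~R = 1 :> R by []; rewrite periodize_step//; apply/andP; lra.
- have f00 : frac_part x = 0 by have := frac_partK x; rewrite e; lra.
  have -> : 2%:~R = 1 + 1 :> R by [].
  rewrite f00 add0r periodize_step; last by apply/andP; lra.
  by rewrite -[1 in RHS]add0r periodize_step//; apply/andP; lra.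
Qed.

Lemma gper_continuous : continuous gper.
Proof.
move=> x; apply/cvgrPdist_le => e e0.
(* [frac_part] jumps at integers, so near [x] it is replaced by the translation by the fixed integer
   [Num.floor x]. *)
have gperE y : `|x - y| <= 2^-1 -> gper y = periodize g (y - (Num.floor x)%:~R).
  rewrite ler_norml => /andP[? ?]; have := floor_itv x; rewrite intrD => /andP[? ?].
  rewrite -periodize_frac; last by apply/andP; lra.
  rewrite /gper -[in LHS](subrK (Num.floor x)%:~R y).
  by rewrite (periodic1z _ _ frac_part_periodic).
have cf : {for x, continuous (fun y : R => periodize g (y - (Num.floor x)%:~R))}.
  apply: continuous_comp; last exact/periodize_continuous/(concave_bump_continuous gb).
  by apply: continuousB; [exact: cvg_id|exact: cvg_cst].
near=> y.
have xy : `|x - y| <= 2^-1.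
  by near: y; apply: (@cvgr_dist_le _ _ _ _ _ id x cvg_id).
rewrite (gperE y xy) (gperE x) ?subrr ?normr0//.
by near: y; exact: (@cvgr_dist_le _ _ _ _ _ _ _ cf).
Unshelve. all: by end_near. Qed.

(** On [[0, 1]] the error of the periodization is the sum of the errors of the translates of [g], so
    its L1 norm on the circle is at most that of [g] on the line. *)
Lemma concave_bump_discrepancy alpha : 0 < alpha -> diophantine alpha ->
  exists B, forall N y, `|\sum_(n < N) periodize g (frac_part (y + n%:R * alpha))
     - N%:R * (Phi b - Phi a)| <= B.
Proof.
move=> a0 aD; have am' := am; have bm' := bm.
have [[ab c0] g0 gout _ gsqrt] := gb.
have gper1 : periodic gper 1 by move=> z; rewrite /gper frac_part_periodic.
have [Phi' dPhi'] := exists_antiderivative gper_continuous.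
have [Psi' dPsi'] := exists_antiderivative (is_derive_continuous dPhi').
have [Psi dPsi] := exists_antiderivative (is_derive_continuous dPhi).
have incr (s t : R) : -1 <= s -> s <= t -> t <= 2 ->
    Phi' t - Phi' s = periodize Phi t - periodize Phi s.
  move=> s1 st t2; have gE z : s < z < t -> gper z = periodize g z.
    by move=> /andP[? ?]; rewrite /gper periodize_frac//; apply/andP; lra.
  have dP := fun x => is_derive_periodize x dPhi.
  apply/eqP; rewrite eq_le; apply/andP; split.
    by apply: (ler_increment dPhi' dP st) => z /gE ->.
  by apply: (ler_increment dP dPhi' st) => z /gE ->.
have lamE : Phi' 1 - Phi' 0 = Phi b - Phi a.
  have -> : Phi' 1 - Phi' 0 = periodize Phi 1 - periodize Phi 0 by apply: incr; lra.
  rewrite -[X in periodize Phi X - _]add0r periodize_shift add0r sub0r.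
  congr (_ - _).
    by apply: (antiderivative_right gb dPhi); lra.
  by apply: (antiderivative_left gb dPhi); lra.
have Phi1 := antiderivative_periodic gper1 dPhi'; rewrite lamE in Phi1.
pose h w x := g x - (Phi (x + w) - Phi (x - w)) / (2 * w).
pose h' w x := gper x - (Phi' (x + w) - Phi' (x - w)) / (2 * w).
have h'E w x : 0 < w -> w <= 1 -> 0 <= x <= 1 -> h' w x = periodize (h w) x.
  move=> w0 w1 /andP[x0 x1]; rewrite /h'.
  have -> : Phi' (x + w) - Phi' (x - w) = periodize Phi (x + w) - periodize Phi (x - w).
    by apply: incr; lra.
  rewrite /gper periodize_frac; last by apply/andP; lra.
  rewrite /periodize /h -sumrB mulr_suml -sumrB; apply: eq_bigr => k _.
  by rewrite (addrAC x w) (addrAC x (- w)).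
have h'1 w : periodic (h' w) 1.
  move=> x; rewrite /h' gper1 (addrAC x 1 w) (addrAC x 1) !Phi1.
  by congr (_ - _ / _); ring.
have pow_le j : 16 ^- j <= 1 :> R.
  by rewrite invf_le1 ?exprn_gt0// exprn_ege1// ler1n.
have sqrt_le j (w : R) : w <= 16 ^- j -> Num.sqrt w <= 4 ^- j.
  move=> wj; apply: sqrtr_le; first by rewrite invr_ge0 exprn_ge0.
  by rewrite exprVn -exprM mulnC exprM -natrX.
(* One constant for both error hypotheses: the first summand is for the variation, the second for
   the supremum over [m.*2] translates. *)
pose C := 16 * c + m.*2%:R * (2 * c).
have C1 : 0 <= m.*2%:R * (2 * c) by rewrite !mulr_ge0.
apply: (@birkhoff_bounded R alpha (Phi b - Phi a) (m.*2%:R * (c * Num.sqrt (b - a)))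
  C gper Phi' Psi' a0 aD dPhi' dPsi' Phi1).
- move=> x; rewrite /gper /periodize; apply: le_trans (ler_norm_sum _ _ _) _.
  have -> : m.*2%:R * (c * Num.sqrt (b - a)) = \sum_(k < m.*2) c * Num.sqrt (b - a).
    by rewrite sumr_const card_ord mulr_natl.
  apply: ler_sum => k _; set z := _ + _; rewrite ger0_norm//.
  have [zb|bz] := leP z b; last first.
    by rewrite gout ?mulr_ge0 ?sqrtr_ge0//; right; exact: ltW.
  by apply: gsqrt; [lra|left; lra].
- move=> j w w0 wj; have w1 := le_trans wj (pow_le j).
  have ch := @continuous_norm_error _ _ w (concave_bump_continuous gb) (is_derive_continuous dPhi).
  have ch' := @continuous_norm_error _ _ w gper_continuous (is_derive_continuous dPhi').
  have [V dV] := exists_antiderivative ch.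
  have [V' dV'] := exists_antiderivative ch'.
  exists V', (V' 1 - V' 0); split; first split.
  + apply: antiderivative_periodic dV' => z; exact: congr1 (h'1 w z).
  + move=> s t; exact: (smoothing_error_control dPhi' dPsi' dV').
  have : V' 1 - V' 0 <= V (b + w) - V (a - w).
    have dP := fun x => is_derive_periodize x dV.
    apply: (@le_trans _ _ (periodize V 1 - periodize V 0)).
      apply: (ler_increment dV' dP ler01) => z /andP[z0 z1].
      rewrite -/(h' w z) h'E//; last by apply/andP; lra.
      exact: ler_norm_sum.
    rewrite -[X in periodize V X - _]add0r periodize_shift add0r sub0r.
    have -> : V m%:R = V (b + w).
      by apply: (variation_outside gb w0 dPhi dV); [|right]; lra.
    have -> : V (a - w) = V (- m%:R).
      by apply: (variation_outside gb w0 dPhi dV); [|left]; lra.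
    by [].
  move=> le1; have le2 := variation_le gb w0 dPhi dPsi dV.
  apply: le_trans le1 (le_trans le2 _).
  have -> : 64 ^- j = 16 ^- j * 4 ^- j :> R by rewrite -invfM -exprMn -natrM.
  apply: ler_pM; rewrite ?mulr_ge0 ?sqrtr_ge0//; first exact: ltW.
    by rewrite /C; lra.
  by apply: ler_pM; rewrite ?sqrtr_ge0 ?sqrt_le// ltW.
- move=> j w x w0 wj; have w1 := le_trans wj (pow_le j).
  rewrite -/(h' w x) -(frac_partK x) (periodic1z _ _ (h'1 w)).
  have /andP[f0 f1] := frac_part_itv x.
  rewrite h'E//; last by apply/andP; lra.
  apply: le_trans (ler_norm_sum _ _ _) _.
  apply: (@le_trans _ _ (\sum_(k < m.*2) (2 * c * 4 ^- j))).
    apply: ler_sum => k _.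
    apply: le_trans (smoothing_error_sup gb w0 dPhi _) _.
    by rewrite ler_wpM2l ?mulr_ge0// sqrt_le.
  rewrite sumr_const card_ord -[leLHS]mulr_natl mulrA.
  by rewrite ler_wpM2r ?invr_ge0 ?exprn_ge0// /C; lra.
Qed.

End bump.
End Periodization.

(** * Planar convex sets *)

Section PlaneSets.
Variable R : realType.
Implicit Types (S : set (R * R)) (p q : R * R).

Definition convex2 S := forall p q (t : R), S p -> S q -> 0 <= t <= 1 ->
  S (t * p.1 + (1 - t) * q.1, t * p.2 + (1 - t) * q.2).

Lemma convex_set_convex2 S :
  convex_set (S : set (convex_lmodType (R * R)%type)) -> convex2 S.
Proof.
move=> cS p q t Sp Sq /andP[t0 t1].
have := cS p q (Itv01 t0 t1); rewrite !inE => /(_ Sp Sq).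
by congr S.
Qed.

Lemma closure2P S p : closure S p <->
  forall e : R, 0 < e -> exists q, [/\ S q, `|p.1 - q.1| < e & `|p.2 - q.2| < e].
Proof.
split=> [cl e e0|H B].
  have [q [Sq [/= q1 q2]]] := cl (ball p e) (nbhsx_ballx p e e0).
  by exists q.
move/nbhs_ballP => [e /= e0 Be]; have [q [Sq q1 q2]] := H e e0.
by exists q; split => //; exact: Be.
Qed.

Lemma interior2P S p : S° p <->
  exists2 e : R, 0 < e & forall q, `|p.1 - q.1| < e -> `|p.2 - q.2| < e -> S q.
Proof.
split=> [/nbhs_ballP[e /= e0 Be]|[e e0 H]].
  by exists e => // q q1 q2; exact: Be.
by apply/nbhs_ballP; exists e => //= q [q1 q2]; exact: H.
Qed.

Lemma convex2_closure S : convex2 S -> convex2 (closure S).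
Proof.
move=> cS p q t /closure2P clp /closure2P clq /andP[t0 t1]; apply/closure2P => e e0.
have [p' [Sp' p1 p2]] := clp e e0; have [q' [Sq' q1 q2]] := clq e e0.
exists (t * p'.1 + (1 - t) * q'.1, t * p'.2 + (1 - t) * q'.2).
have key (u u' v v' : R) : `|u - u'| < e -> `|v - v'| < e ->
    `|t * u + (1 - t) * v - (t * u' + (1 - t) * v')| < e.
  move=> ue ve; pose M := Num.max `|u - u'| `|v - v'|.
  have Me : M < e by rewrite gt_max ue.
  apply: le_lt_trans Me.
  have : `|u - u'| <= M by rewrite le_max lexx.
  have : `|v - v'| <= M by rewrite le_max lexx orbT.
  rewrite !ler_norml => /andP[v1 v2] /andP[u1 u2].
  have t1' : 0 <= 1 - t by rewrite subr_ge0.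
  have := ler_wpM2l t0 u1; have := ler_wpM2l t0 u2.
  have := ler_wpM2l t1' v1; have := ler_wpM2l t1' v2.
  by move=> ? ? ? ?; apply/andP; split; lra.
by split => /=; [apply: cS => //; apply/andP|exact: key|exact: key].
Qed.

End PlaneSets.

(** * Quadratic growth from a lower bound on the second derivative *)

Section Support.
Variable R : realType.
Implicit Types (f df : R -> R).

Lemma convex_quadratic_right f df ddf (m t0 t : R) :
  (forall x, is_derive x (1 : R) f (df x)) ->
  (forall x, is_derive x (1 : R) df (ddf x)) -> t0 <= t ->
  (forall s, t0 < s < t -> m <= ddf s) -> df t0 = 0 ->
  m / 2 * (t - t0) ^+ 2 <= f t - f t0.
Proof.
move=> fd dfd t0t mle df0.
have dfge s : t0 < s < t -> m * (s - t0) <= df s.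
  move=> /andP[s0 st]; have := ler_increment (is_derive_mull m) dfd (ltW s0).
  rewrite df0 subr0 mulrBr; apply => z /andP[z0 zs]; apply: mle.
  by rewrite z0 (lt_trans zs st).
have d2 x : is_derive x (1 : R) (fun y => m / 2 * (y - t0) ^+ 2) (m * (x - t0)).
  by apply: is_derive_eq; rewrite /GRing.scale/=; field.
have := ler_increment d2 fd t0t dfge.
by rewrite subrr expr0n mulr0 subr0.
Qed.

Lemma convex_quadratic f df ddf (m d t0 t : R) :
  (forall x, is_derive x (1 : R) f (df x)) ->
  (forall x, is_derive x (1 : R) df (ddf x)) ->
  (forall s, `|s - t0| < d -> m <= ddf s) -> df t0 = 0 -> `|t - t0| < d ->
  m / 2 * (t - t0) ^+ 2 <= f t - f t0.
Proof.
move=> fd dfd mle df0 td; have [t0t|tt0] := leP t0 t.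
  apply: (convex_quadratic_right fd dfd t0t _ df0) => s /andP[? ?]; apply: mle.
  by apply: le_lt_trans td; rewrite !ger0_norm; lra.
have dopp (h dh : R -> R) x : (forall x, is_derive x (1 : R) h (dh x)) ->
    is_derive x (1 : R) (fun y => h (- y)) (- dh (- x)).
  move=> hd; have := @is_derive1_comp R h (fun y => - y) x (dh (- x)) (- 1) (hd _).
  have dN : is_derive x (1 : R) (fun y : R => - y) (- 1) by exact: is_deriveN.
  by move=> /(_ dN); rewrite mulrN1.
have fd' x := dopp f df x fd.
have dfd' x : is_derive x (1 : R) (fun y => - df (- y)) (ddf (- x)).
  have := dopp df ddf x dfd => h; rewrite -[ddf _]opprK; exact: is_deriveN.
have := @convex_quadratic_right (fun y => f (- y)) (fun y => - df (- y))
  (fun y => ddf (- y)) m (- t0) (- t) fd' dfd'.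
rewrite lerN2 !opprK df0 oppr0 => /(_ (ltW tt0)) H.
rewrite -sqrrN opprB [t0 - t]addrC; apply: H => // s /andP[? ?]; apply: mle.
by apply: le_lt_trans td; rewrite !ler0_norm; lra.
Qed.

End Support.

(** * Quadratic growth at supporting lines *)

Section CurveQuadraticBound.
Variable R : realType.
Implicit Types (S : set (R * R)) (p q : R * R).

Lemma C2_is_derive (f : R -> R) : twice_continuously_differentiable f ->
  (forall t, is_derive t (1 : R) f (derive1 f t)) /\
  (forall t, is_derive t (1 : R) (derive1 f) (derive1n 2 f t)).
Proof.
move=> [d1 d2 _]; split => t.
  exact: (DeriveDef (d1 t) (esym (derive1E f t))).
rewrite derive1nS derive1n1.
exact: (DeriveDef (d2 t) (esym (derive1E (derive1 f) t))).
Qed.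

Lemma near_dist_le (f : R -> R) (t e : R) : {for t, continuous f} -> 0 < e ->
  \forall s \near t, `|f t - f s| <= e.
Proof. by move=> /cvgrPdist_le; apply. Qed.

Lemma near_ge_half (f : R -> R) (t : R) : {for t, continuous f} -> 0 < f t ->
  \forall s \near t, f t / 2 <= f s.
Proof.
move=> cf f0; have : \forall s \near t, `|f t - f s| <= f t / 2.
  by apply: near_dist_le => //; lra.
by apply: filterS => s; rewrite ler_norml => /andP[? ?]; lra.
Qed.

Lemma min_quadratic_growth (f df ddf : R -> R) (t : R) :
  (forall s, is_derive s (1 : R) f (df s)) ->
  (forall s, is_derive s (1 : R) df (ddf s)) -> continuous ddf ->
  (forall s, f t <= f s) -> df t = 0 -> ddf t != 0 ->
  exists2 k : R, 0 < k & \forall s \near t, k * (s - t) ^+ 2 <= f s - f t.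
Proof.
move=> fd dfd cddf fmin df0 dd0.
have [e0|] := ltP 0 (ddf t).
  exists (ddf t / 2 / 2); first by lra.
  have /nbhs_ballP[d /= d0 H] := near_ge_half (cddf t) e0.
  apply/nbhs_ballP; exists d => //= s sd.
  apply: (@convex_quadratic R f df ddf (ddf t / 2) d t s fd dfd _ df0).
    by move=> u ud; apply: H; rewrite /ball/= distrC.
  by rewrite distrC.
(* A negative second derivative would make [t] a strict local maximum, against minimality at
   [t + d / 2]. *)
rewrite le_eqVlt (negPf dd0) /= => e0; exfalso.
have cN : {for t, continuous (fun s => - ddf s)} by apply: continuousN; exact: cddf.
have e0' : 0 < - ddf t by lra.
have /nbhs_ballP[d /= d0 H] := near_ge_half cN e0'.
have dN1 s : is_derive s (1 : R) (fun s => - f s) (- df s).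
  exact: (is_deriveN (fd s)).
have dN2 s : is_derive s (1 : R) (fun s => - df s) (- ddf s).
  exact: (is_deriveN (dfd s)).
have := @convex_quadratic R _ _ _ (- ddf t / 2) d t (t + d / 2) dN1 dN2.
rewrite df0 oppr0 addrAC subrr add0r => HH.
have : - ddf t / 2 / 2 * (d / 2) ^+ 2 <= - f (t + d / 2) - - f t.
  apply: HH => //; last by rewrite gtr0_norm; lra.
  by move=> u ud; apply: H; rewrite /ball/= distrC.
have := fmin (t + d / 2).
have : 0 < - ddf t / 2 / 2 * (d / 2) ^+ 2.
  by rewrite mulr_gt0 ?exprn_gt0//; lra.
by lra.
Qed.

Variables (S : set (R * R)) (L : R) (x y : R -> R) (c1 c2 a : R).
Hypothesis cS : convex2 S.
Hypothesis par : C2_parametrization (boundary S) L x y.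
Hypothesis curv : forall t, 0 < curvature x y t.
Hypothesis c20 : c2 != 0.
Let l (p : R * R) := c1 * p.1 + c2 * p.2.
Hypothesis aS : forall p, S p -> a <= l p.

Lemma closure_ge p : closure S p -> a <= l p.
Proof.
move=> /closure2P clp; apply/ler_addgt0Pr => e e0.
pose k := `|c1| + `|c2|.
have k0 : 0 < k by rewrite ltr_wpDl// normr_gt0.
have [q [Sq q1 q2]] := clp (e / k) (divr_gt0 e0 k0).
apply: le_trans (aS Sq) _; rewrite -lerBlDl.
apply: le_trans (ler_norm _) _.
have -> : l q - l p = c1 * (q.1 - p.1) + c2 * (q.2 - p.2) by rewrite /l; ring.
apply: le_trans (ler_normD _ _) _; rewrite !normrM.
have -> : e = `|c1| * (e / k) + `|c2| * (e / k).
  by rewrite -mulrDl -/k mulrC divfK// gt_eqF.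
by apply: lerD; rewrite ler_wpM2l// distrC ltW.
Qed.

Lemma boundary_closure p : boundary S p -> closure S p.
Proof. by case. Qed.

Lemma closure_min_boundary p : closure S p -> l p = a -> boundary S p.
Proof.
move=> clp lp; split => // /interior2P[e e0 H].
have c20' := c20.
pose q := (p.1, p.2 - Num.sg c2 * (e / 2)).
have sq : `|Num.sg c2| = 1 by rewrite normr_sg c20.
have Sq : S q.
  apply: H => /=; first by rewrite subrr normr0.
  by rewrite opprB addrC subrK normrM sq mul1r gtr0_norm; lra.
have := aS Sq; rewrite -lp /l /q /=.
have : 0 < `|c2| * (e / 2) by rewrite mulr_gt0 ?normr_gt0//; lra.
have -> : `|c2| * (e / 2) = c2 * (Num.sg c2 * (e / 2)) by rewrite normrEsg; ring.
by lra.
Qed.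

Let phi t := c1 * x t + c2 * y t.
Let dphi t := c1 * derive1 x t + c2 * derive1 y t.
Let ddphi t := c1 * derive1n 2 x t + c2 * derive1n 2 y t.

Lemma curve_boundary t : boundary S (x t, y t).
Proof. by case: par => _ _ _ _ <-; exists t. Qed.

Lemma boundary_curve p : boundary S p ->
  exists2 t, 0 <= t <= L & p = (x t, y t).
Proof.
case: par => -[L0 [xL yL]] _ _ _ <- [t _ <-].
have perz (f : R -> R) s (k : int) : periodic f L -> f (s + k%:~R * L) = f s.
  move=> fL; case: k => n; first by rewrite mulr_natl (periodicn fL).
  rewrite NegzE mulrNz mulNr -(periodicn fL n.+1 (s - _)) -pmulrn mulr_natl.
  by rewrite subrK.
pose k := Num.floor (t / L).
exists (t - k%:~R * L); last first.
  by rewrite -[in LHS](subrK (k%:~R * L) t) !perz.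
have := floor_itv (t / L); rewrite -/k intrD => /andP[].
rewrite ler_pdivlMr// ltr_pdivrMr// mulrDl mul1r => ? ?.
by apply/andP; split; lra.
Qed.

Let ge_phi t : a <= phi t.
Proof. exact: (closure_ge (boundary_closure (curve_boundary t))). Qed.

Let dphiE t : is_derive t (1 : R) phi (dphi t).
Proof.
case: par => _ [/C2_is_derive[dx _] /C2_is_derive[dy _]] _ _ _.
by have := dx t; have := dy t => ? ?; apply: is_derive_eq.
Qed.

Let ddphiE t : is_derive t (1 : R) dphi (ddphi t).
Proof.
case: par => _ [/C2_is_derive[_ dx] /C2_is_derive[_ dy]] _ _ _.
by have := dx t; have := dy t => ? ?; apply: is_derive_eq.
Qed.

Let continuous_ddphi : continuous ddphi.
Proof.
case: par => _ [[_ _ cx] [_ _ cy]] _ _ _ t.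
apply: (@continuousD _ R R (fun t => c1 * derive1n 2 x t) (fun t => c2 * derive1n 2 y t)).
  by apply: (@continuousM _ R (fun=> c1) (derive1n 2 x)); [exact: cvg_cst|exact: cx].
by apply: (@continuousM _ R (fun=> c2) (derive1n 2 y)); [exact: cvg_cst|exact: cy].
Qed.

Let continuous_phi : continuous phi := is_derive_continuous dphiE.

Let dphi0 t : phi t = a -> dphi t = 0.
Proof.
move=> pt; have := @derive1_at_min R phi (t - 1) (t + 1) t.
have le : t - 1 <= t + 1 by lra.
have dph s : derivable phi s 1 by case: (dphiE s).
move=> /(_ le (fun s _ => dph s)) H.
have ti : t \in `]t - 1, t + 1[%R by rewrite in_itv/=; apply/andP; lra.
have {}H : is_derive t (1 : R) phi 0 by apply: H => // s _; rewrite pt.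
have := dphiE t => d.
by rewrite -(@derive_val _ _ _ t 1 phi _ d) (@derive_val _ _ _ t 1 phi _ H).
Qed.

(** At a minimum the velocity is orthogonal to [(c1, c2)]; were the acceleration so too, both would
    be parallel and the curvature zero. *)
Let ddphi_neq0 t : phi t = a -> ddphi t != 0.
Proof.
move=> /dphi0; rewrite /dphi => d0; apply/eqP; rewrite /ddphi => dd0.
have c20' := c20.
have := curv t; rewrite /curvature.
have -> : derive1 x t * derive1n 2 y t - derive1 y t * derive1n 2 x t = 0.
  have det (X Y X' Y' : R) : c1 * X + c2 * Y = 0 -> c1 * X' + c2 * Y' = 0 ->
      X * Y' - Y * X' = 0.
    move=> e e'; apply: (mulfI c20').
    transitivity (X * (c1 * X' + c2 * Y') - X' * (c1 * X + c2 * Y)); first by ring.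
    by rewrite e e' !mulr0 subrr.
  exact: det.
by rewrite normr0 mul0r ltxx.
Qed.

Let local_growth t : phi t = a ->
  exists2 k : R, 0 < k & \forall s \near t, k * (s - t) ^+ 2 <= phi s - a.
Proof.
move=> pt; rewrite -pt; apply: (min_quadratic_growth dphiE ddphiE).
- exact: continuous_ddphi.
- by move=> s; rewrite pt; exact: ge_phi.
- exact: dphi0.
- exact: ddphi_neq0.
Qed.

Let minimizers_isolated t : phi t = a -> \forall s \near t, phi s = a -> s = t.
Proof.
move=> /local_growth[k k0]; apply: filterS => s + ps; rewrite ps subrr.
by rewrite pmulr_rle0// exprn_even_le0//= subr_eq0 => /eqP.
Qed.

(* Otherwise the boundary would contain a whole segment of minimizers, although
   minimizers are isolated. *)
Let unique_abscissa t1 t2 : phi t1 = a -> phi t2 = a -> x t1 <= x t2 -> x t1 = x t2.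
Proof.
move=> p1 p2 x12; apply/eqP; rewrite eq_le x12 leNgt; apply/negP => lt.
pose P (e : R) t := phi t = a -> ~~ (x t1 < x t < x t1 + e).
(* Isolation of minimizers and compactness leave a whole strip to the right of [x t1] free of
   them. *)
have : \forall e \near 0^'+, `[0, L]%classic `<=` P e.
  have /compact_near_coveringP := @segment_compact R 0 L; apply => t _.
  have [pt|npt] := pselect (phi t = a); last first.
    have pa : a < phi t by rewrite lt_neqAle ge_phi andbT eq_sym; apply/eqP.
    have : \forall s \near t, phi s <> a.
      have : \forall s \near t, `|phi t - phi s| <= (phi t - a) / 2.
        by apply: near_dist_le; [exact: continuous_phi|lra].
      by apply: filterS => s + e; rewrite e ler_norml => /andP[_ ?]; lra.
    move=> H; near=> s e => /= ps; exfalso; move: ps.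
    by near: s.
  have [xt|xt] := leP (x t) (x t1).
    near=> s e => /= ps.
    have -> : s = t by move: ps; near: s; exact: minimizers_isolated.
    by rewrite ltNge xt.
  near=> s e => /= ps.
  have -> : s = t by move: ps; near: s; exact: minimizers_isolated.
  rewrite negb_and -!leNgt; apply/orP; right.
  rewrite -lerBrDl; near: e.
  by apply: nbhs_right_le; rewrite subr_gt0.
move=> H; have [e [e0 He]] : exists e : R, 0 < e /\ `[0, L]%classic `<=` P e.
  have : \forall e \near 0^'+, 0 < e /\ `[0, L]%classic `<=` P e.
    by near=> e; split; [near: e; exact: nbhs_right_gt|near: e].
  by move=> /(@filter_ex _ _ _)[e ?]; exists e.
(* The point of the segment with abscissa [x t1 + d] lies in that strip, yet it is again a
   minimizer. *)
pose d := Num.min (e / 2) (x t2 - x t1).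
have d0 : 0 < d by rewrite lt_min subr_gt0 lt andbT divr_gt0.
have dl : d <= x t2 - x t1 by rewrite ge_min lexx orbT.
have de : d < e by rewrite gt_min; apply/orP; left; lra.
pose s := 1 - d / (x t2 - x t1).
have dx0 : 0 < x t2 - x t1 by lra.
have s01 : 0 <= s <= 1.
  have : d / (x t2 - x t1) <= 1 by rewrite ler_pdivrMr// mul1r.
  have : 0 <= d / (x t2 - x t1) by rewrite divr_ge0// ltW.
  by move=> ? ?; rewrite /s; apply/andP; lra.
have clp := convex2_closure cS (boundary_closure (curve_boundary t1))
  (boundary_closure (curve_boundary t2)) s01.
set p := (_, _) in clp; have lp : l p = a.
  rewrite /l /p /=; transitivity (s * phi t1 + (1 - s) * phi t2).
    by rewrite /phi; ring.
  by rewrite p1 p2; ring.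
have px : p.1 = x t1 + d.
  rewrite /p /= /s; field; exact: lt0r_neq0.
have [t tL pt] := boundary_curve (closure_min_boundary clp lp).
have /He : `[0, L]%classic t by rewrite /= in_itv.
have pht : phi t = a by rewrite -lp pt.
move=> /(_ pht); rewrite -[x t]/((x t, y t).1) -pt px.
by rewrite ltrDl d0 ltrD2l de.
Unshelve. all: by end_near. Qed.

(** [u0] is the abscissa of contact with the line [l = a]. Near a contact the bound is quadratic
    growth; elsewhere [l - a] is locally bounded below; compactness makes [C] uniform. If there is
    no contact, any [u0] serves. *)
Lemma curve_quadratic_bound : exists C u0 : R, 0 <= C /\
  forall p, boundary S p -> (p.1 - u0) ^+ 2 <= C * (l p - a).
Proof.
have [u0 u0P] : exists u0 : R, forall t, phi t = a -> x t = u0.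
  have [[t1 p1]|/forallNP nE] := pselect (exists t, phi t = a); last first.
    by exists 0 => t /nE.
  exists (x t1) => t pt; case/orP: (le_total (x t) (x t1)) => h.
    exact: unique_abscissa.
  by apply/esym/unique_abscissa.
case: (par) => _ [/C2_is_derive[dx _] _] _ _ _.
have cx : continuous x := is_derive_continuous dx.
pose P (C : R) t := 0 <= C /\ (x t - u0) ^+ 2 <= C * (phi t - a).
have : \forall C \near +oo, `[0, L]%classic `<=` P C.
  have /compact_near_coveringP := @segment_compact R 0 L; apply => t _.
  have [pt|npt] := pselect (phi t = a); last first.
    have pa : 0 < phi t - a.
      by rewrite subr_gt0 lt_neqAle ge_phi andbT eq_sym; apply/eqP.
    pose B := (`|x t - u0| + 1) ^+ 2.
    near=> s C => /=.
    have hs : (phi t - a) / 2 <= phi s - a.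
      have : `|phi t - phi s| <= (phi t - a) / 2.
        near: s; apply: near_dist_le; first exact: continuous_phi.
        by rewrite divr_gt0.
      by rewrite ler_norml => /andP[? ?]; lra.
    have hx : (x s - u0) ^+ 2 <= B.
      rewrite -[leLHS]real_normK ?num_real// ler_pXn2r ?nnegrE ?addr_ge0//.
      have : `|x t - x s| <= 1 by near: s; apply: near_dist_le; [exact: cx|].
      have := ler_distD (x t) (x s) u0; rewrite (distrC (x s) (x t)); lra.
    have hC : B / ((phi t - a) / 2) <= C.
      by near: C; apply: nbhs_pinfty_ge; rewrite num_real.
    have B0 : 0 <= B by rewrite sqr_ge0.
    have C0 : 0 <= C.
      by apply: le_trans hC; rewrite !divr_ge0// ltW.
    split => //; apply: le_trans hx _.
    rewrite ler_pdivrMr ?divr_gt0// in hC.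
    by apply: le_trans hC _; rewrite ler_wpM2l.
  have [k k0 kP] := local_growth pt.
  (* The slope [G] is bounded near [t], so [(x s - x t) ^+ 2] is at most a multiple of
     [(s - t) ^+ 2], and thus of [phi s - a]. *)
  have /is_derive1_caratheodory[G [GE cG _]] := dx t.
  pose M := `|G t| + 1.
  near=> s C => /=.
  have hG : `|G s| <= M.
    have : `|G t - G s| <= 1 by near: s; apply: near_dist_le; [exact: cG|].
    by have := lerB_dist (G s) (G t); rewrite distrC /M; lra.
  have hk : k * (s - t) ^+ 2 <= phi s - a by near: s.
  have hC : M ^+ 2 / k <= C.
    by near: C; apply: nbhs_pinfty_ge; rewrite num_real.
  have C0 : 0 <= C by apply: le_trans hC; rewrite divr_ge0 ?sqr_ge0// ltW.
  split => //; rewrite -(u0P t pt) GE exprMn.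
  apply: (@le_trans _ _ (M ^+ 2 * (s - t) ^+ 2)).
    rewrite ler_wpM2r ?sqr_ge0// -[leLHS]real_normK ?num_real// ler_pXn2r ?nnegrE//.
    by rewrite addr_ge0.
  apply: (@le_trans _ _ (C * (k * (s - t) ^+ 2))); last by rewrite ler_wpM2l.
  by rewrite [leRHS]mulrA ler_wpM2r ?sqr_ge0// -ler_pdivrMr.
move=> /(@filter_ex _ _ _)[C CP]; exists C, u0.
have [L0] : 0 < L by case: par => -[].
have C0 : 0 <= C by have [] := CP 0; rewrite //= in_itv/= lexx ltW.
split => // p /boundary_curve[t tL ->].
by have [] := CP t; rewrite //= in_itv.
Unshelve. all: by end_near. Qed.

End CurveQuadraticBound.

(** * Chords *)

Section Chord.
Variable R : realType.

Definition chord_set (S : set (R * R)) (alpha s : R) : set R :=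
  [set t | S (t, s + alpha * t)].

(* As sup set0 = inf set0 = 0, the length is 0 where the line misses S. *)
Definition chord (S : set (R * R)) (alpha s : R) : R :=
  sup (chord_set S alpha s) - inf (chord_set S alpha s).

Lemma le_sqrt_abs (u K : R) : u ^+ 2 <= K -> `|u| <= Num.sqrt K.
Proof. by move=> uK; rewrite -sqrtr_sqr ler_wsqrtr. Qed.

Variables (S : set (R * R)) (alpha : R).
Hypotheses (Ssq : S `<=` @unit_square R) (cS : convex2 S) (alpha0 : 0 < alpha).
Local Notation I := (chord_set S alpha).

Lemma chord_set_itv s t : I s t -> 0 <= t < 1.
Proof. by move=> /Ssq[]. Qed.

Lemma chord_set_level s t : I s t -> - alpha <= s <= 1.
Proof.
have a0 := alpha0; move=> /Ssq[/= /andP[t0 t1] /andP[s0 s1]].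
have : alpha * t <= alpha * 1 by rewrite ler_wpM2l// ltW.
have : 0 <= alpha * t by rewrite mulr_ge0// ltW.
by move=> ? ?; apply/andP; lra.
Qed.

Lemma has_sup_chord s : I s !=set0 -> has_sup (I s).
Proof. by move=> I0; split => //; exists 1 => t /chord_set_itv/andP[_ /ltW]. Qed.

Lemma has_inf_chord s : I s !=set0 -> has_inf (I s).
Proof. by move=> I0; split => //; exists 0 => t /chord_set_itv/andP[]. Qed.

Lemma chord_empty s : ~ (I s !=set0) -> chord S alpha s = 0.
Proof.
by move=> /set0P/negP/negPn/eqP I0; rewrite /chord I0 sup0 inf0 subrr.
Qed.

Lemma le_sup_chord s t : I s t -> t <= sup (I s).
Proof. by move=> It; apply: ub_le_sup => //; have [] := has_sup_chord (ex_intro _ t It). Qed.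

Lemma ge_inf_chord s t : I s t -> inf (I s) <= t.
Proof. by move=> It; apply: ge_inf => //; have [] := has_inf_chord (ex_intro _ t It). Qed.

Lemma chord_ge0 s : 0 <= chord S alpha s.
Proof.
have [[t It]|/chord_empty->//] := pselect (I s !=set0).
by rewrite subr_ge0 (le_trans (ge_inf_chord It))// le_sup_chord.
Qed.

Lemma chord_set_mix s s' t u u' : I s u -> I s' u' -> 0 <= t <= 1 ->
  I (t * s + (1 - t) * s') (t * u + (1 - t) * u').
Proof.
move=> Iu Iu' t01; have := cS Iu Iu' t01; rewrite /chord_set/=.
by congr (S (_, _)); ring.
Qed.

Lemma line_boundary s u :
  (forall e, 0 < e -> exists2 u', I s u' & `|u - u'| < e) ->
  (forall e, 0 < e -> exists2 u', ~ I s u' & `|u - u'| < e) ->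
  boundary S (u, s + alpha * u).
Proof.
have a0 := alpha0; move=> near_in near_out.
have dist e u' : 0 < e -> `|u - u'| < e / (alpha + 1) ->
    `|u - u'| < e /\ `|s + alpha * u - (s + alpha * u')| < e.
  move=> e0; rewrite ltr_pdivlMr; last by lra.
  have -> : s + alpha * u - (s + alpha * u') = alpha * (u - u') by ring.
  rewrite normrM (gtr0_norm alpha0) mulrDr mulr1 mulrC.
  have := normr_ge0 (u - u') => n0.
  have : 0 <= alpha * `|u - u'| by rewrite mulr_ge0// ltW.
  have [->|nz] := eqVneq `|u - u'| 0; first by rewrite mulr0.
  have : 0 < alpha * `|u - u'| by rewrite mulr_gt0// lt_neqAle eq_sym nz.
  by move=> ? ? ?; split; lra.
have d0 e : 0 < e -> 0 < e / (alpha + 1) by move=> e0; rewrite divr_gt0//; lra.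
split.
  apply/closure2P => e e0; have [u' Iu' /(dist e u' e0)[h1 h2]] := near_in _ (d0 e e0).
  by exists (u', s + alpha * u').
move=> /interior2P[e e0 H]; have [u' nIu' /(dist e u' e0)[h1 h2]] := near_out _ (d0 e e0).
by apply: nIu'; exact: H.
Qed.

Lemma sup_chord_boundary s : I s !=set0 ->
  boundary S (sup (I s), s + alpha * sup (I s)).
Proof.
move=> I0; apply: line_boundary => e e0.
  have [u Iu lt] := sup_adherent e0 (has_sup_chord I0).
  exists u => //; have := le_sup_chord Iu => ?; rewrite ger0_norm; lra.
exists (sup (I s) + e / 2); first by move=> /le_sup_chord; lra.
by rewrite opprD addrA subrr add0r normrN gtr0_norm; lra.
Qed.

Lemma inf_chord_boundary s : I s !=set0 ->
  boundary S (inf (I s), s + alpha * inf (I s)).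
Proof.
move=> I0; apply: line_boundary => e e0.
  have [u Iu lt] := inf_adherent e0 (has_inf_chord I0).
  exists u => //; have := ge_inf_chord Iu => ?; rewrite ler0_norm; lra.
exists (inf (I s) - e / 2); first by move=> /ge_inf_chord; lra.
by rewrite opprB addrC subrK gtr0_norm; lra.
Qed.

Lemma chord_sqrt_bound (K u0 s : R) :
  (forall u, boundary S (u, s + alpha * u) -> (u - u0) ^+ 2 <= K) ->
  chord S alpha s <= 2 * Num.sqrt K.
Proof.
move=> KP; have [I0|/chord_empty->] := pselect (I s !=set0); last first.
  by rewrite mulr_ge0 ?sqrtr_ge0.
have := le_sqrt_abs (KP _ (sup_chord_boundary I0)).
have := le_sqrt_abs (KP _ (inf_chord_boundary I0)).
by rewrite !ler_norml /chord => /andP[? ?] /andP[? ?]; lra.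
Qed.

(** Brunn-Minkowski in dimension one: the chord at the mixed level contains the mixture of the two
    chords. Ends need not be attained, hence the approximation by [e / 2]. *)
Lemma chord_concave s s' t : I s !=set0 -> I s' !=set0 -> 0 <= t <= 1 ->
  t * chord S alpha s + (1 - t) * chord S alpha s' <=
  chord S alpha (t * s + (1 - t) * s').
Proof.
move=> I0 I0' t01; have /andP[t0 t1] := t01; have t1' : 0 <= 1 - t by lra.
apply/ler_addgt0Pr => e e0; have e20 : 0 < e / 2 by lra.
have [u Iu ult] := sup_adherent e20 (has_sup_chord I0).
have [u' Iu' ult'] := sup_adherent e20 (has_sup_chord I0').
have [v Iv vlt] := inf_adherent e20 (has_inf_chord I0).
have [v' Iv' vlt'] := inf_adherent e20 (has_inf_chord I0').
have := le_sup_chord (chord_set_mix Iu Iu' t01).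
have := ge_inf_chord (chord_set_mix Iv Iv' t01).
have h1 : t * (sup (I s) - inf (I s)) <= t * (u - v + e) by rewrite ler_wpM2l//; lra.
have h2 : (1 - t) * (sup (I s') - inf (I s')) <= (1 - t) * (u' - v' + e).
  by rewrite ler_wpM2l//; lra.
rewrite /chord; lra.
Qed.

Let lev p : R := p.2 - alpha * p.1.

Lemma chord_set_lev p : S p -> I (lev p) p.1.
Proof. by case: p => p1 p2; rewrite /chord_set/lev/= subrK. Qed.

(** [a] and [b] are the levels of the supporting lines of slope [alpha]. The quadratic bound is
    applied to [p.2 - alpha * p.1] and to its opposite; both end points of a chord are boundary
    points, hence close to the contact. *)
Lemma chord_concave_bump : C2_curve_of_positive_curvature (boundary S) ->
  exists a b c, [/\ concave_bump (chord S alpha) a b c, - alpha <= a, b <= 1 &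
    forall s, I s !=set0 -> a <= s <= b].
Proof.
move=> [L [x [y [par curv]]]].
have [p Sp] : S !=set0.
  have /closure2P/(_ _ ltr01)[q [Sq _ _]] := boundary_closure (curve_boundary par 0).
  by exists q.
pose Lv := [set s | I s !=set0].
have Lv0 : Lv !=set0 by exists (lev p), p.1; exact: chord_set_lev.
have hasI : has_inf Lv by split => //; exists (- alpha) => s [t /chord_set_level/andP[]].
have hasS : has_sup Lv by split => //; exists 1 => s [t /chord_set_level/andP[]].
pose a := inf Lv; pose b := sup Lv.
have Lab s : I s !=set0 -> a <= s <= b.
  by move=> Is; rewrite ge_inf ?ub_le_sup//; [case: hasS|case: hasI].
have aS q : S q -> a <= - alpha * q.1 + 1 * q.2.
  move=> /chord_set_lev h; have /andP[] := Lab _ (ex_intro _ _ h).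
  by rewrite /lev; lra.
have bS q : S q -> - b <= alpha * q.1 + (-1) * q.2.
  move=> /chord_set_lev h; have /andP[] := Lab _ (ex_intro _ _ h).
  by rewrite /lev; lra.
have [C1 [u1 [C10 H1]]] := curve_quadratic_bound cS par curv (oner_neq0 _) aS.
have N10 : (-1 : R) != 0 by rewrite oppr_eq0 oner_neq0.
have [C2 [u2 [C20 H2]]] := curve_quadratic_bound cS par curv N10 bS.
pose C := C1 + C2.
have B1 s : chord S alpha s <= 2 * Num.sqrt (C1 * (s - a)).
  apply: (@chord_sqrt_bound _ u1) => u /H1 /=.
  by have -> : - alpha * u + 1 * (s + alpha * u) - a = s - a by ring.
have B2 s : chord S alpha s <= 2 * Num.sqrt (C2 * (b - s)).
  apply: (@chord_sqrt_bound _ u2) => u /H2 /=.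
  by have -> : alpha * u + -1 * (s + alpha * u) - - b = b - s by ring.
have ab : a <= b by have /andP[] := Lab _ (ex_intro _ _ (chord_set_lev Sp)); exact: le_trans.
(* Convexity makes the levels that meet [S] an interval; [a] and [b] themselves may be missing. *)
have inner s : a < s < b -> I s !=set0.
  move=> /andP[as_ sb].
  have sa0 : 0 < s - a by lra.
  have bs0 : 0 < b - s by lra.
  have [s1 [v1 I1] lt1] := inf_adherent sa0 hasI; rewrite -/a in lt1.
  have [s2 [v2 I2] lt2] := sup_adherent bs0 hasS; rewrite -/b in lt2.
  have s12 : 0 < s2 - s1 by lra.
  pose t := (s2 - s) / (s2 - s1).
  have tE : t * (s2 - s1) = s2 - s by rewrite divfK// gt_eqF.
  have t01 : 0 <= t <= 1.
    by rewrite /t ler_pdivrMr// ler_pdivlMr//; apply/andP; lra.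
  have := chord_set_mix I1 I2 t01.
  have -> : t * s1 + (1 - t) * s2 = s by lra.
  by move=> It; exists (t * v1 + (1 - t) * v2).
exists a, b, (2 * Num.sqrt C); split => //; last 2 first.
- by apply: lb_le_inf => // s [t /chord_set_level/andP[]].
- by apply: ge_sup => // s [t /chord_set_level/andP[]].
split.
- by split => //; rewrite mulr_ge0 ?sqrtr_ge0.
- exact: chord_ge0.
- move=> s [sa|bs]; apply/eqP; rewrite eq_le chord_ge0 andbT.
    apply: le_trans (B1 s) _; rewrite ler0_sqrtr ?mulr0//.
    by rewrite mulr_ge0_le0// subr_le0.
  apply: le_trans (B2 s) _; rewrite ler0_sqrtr ?mulr0//.
  by rewrite mulr_ge0_le0// subr_le0.
- by move=> s s' t hs hs' t01; apply: chord_concave => //; exact: inner.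
- move=> s d d0 h; rewrite -mulrA -sqrtrM; last by rewrite /C addr_ge0.
  case: h => h; [apply: le_trans (B1 s) _|apply: le_trans (B2 s) _];
    rewrite ler_wpM2l// ler_wsqrtr//.
    by apply: (@le_trans _ _ (C1 * d)); rewrite ?ler_wpM2l// ler_wpM2r// /C lerDl.
  by apply: (@le_trans _ _ (C2 * d)); rewrite ?ler_wpM2l// ler_wpM2r// /C lerDr.
Qed.

End Chord.

(** * Measure in the plane *)

Section PlaneMeasure.
Variable R : realType.
Local Notation mu := (@lebesgue_measure R).
Local Notation mu2 := ((@lebesgue_measure R) \x (@lebesgue_measure R))%E.
Local Notation plane := (measurableTypeR R * measurableTypeR R)%type.

Lemma measurable_bounded_interval (E : set R) : is_interval E -> measurable E.
Proof. by move=> /is_intervalP ->; exact: measurable_itv. Qed.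

Lemma lebesgue_measure_bounded_interval (E : set R) : is_interval E ->
  has_lbound E -> has_ubound E -> mu E = (sup E - inf E)%:E.
Proof.
move=> iE lE uE; have [/eqP->|/set0P E0] := boolP (E == set0).
  by rewrite measure0 sup0 inf0 subrr.
rewrite {1}((is_intervalP E).1 iE) lebesgue_measure_itv /Rhull.
rewrite (asboolT lE) (asboolT uE)/= lte_fin -EFinB.
case: ltP => // le; congr EFin; apply/esym/eqP; rewrite subr_eq0 eq_le le /=.
by have [x Ex] := E0; rewrite (le_trans (ge_inf lE Ex))// ub_le_sup.
Qed.

Lemma measurable_translate (c : R) : measurable_fun [set: R] (fun x : R => x + c).
Proof. by apply: measurable_funD => //; exact: measurable_cst. Qed.

Lemma lebesgue_measure_translate (c : R) (A : set R) : measurable A ->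
  mu [set x | A (x + c)] = mu A.
Proof.
move=> mA; apply/esym.
pose f : measurableTypeR R -> measurableTypeR R := fun x => x + c.
have mf : measurable_fun setT f by exact: measurable_translate.
apply: (@lebesgue_measure_unique R
  (measure_function_pushforward__canonical__measure_function_Measure mu mf));
  last by [].
move=> /= _ [[u v] _ <-]/=.
rewrite /pushforward (_ : _ @^-1` _ = `]u - c, v - c]%classic).
  by rewrite !lebesgue_measure_itv/= !lte_fin ltrD2r -!EFinB opprB addrA subrK.
by apply/seteqP; split => x /=; rewrite !in_itv/= ltrBlDr lerBrDr.
Qed.

Lemma open_measurable2 (U : set (R * R)) : open U -> measurable (U : set plane).
Proof.
move=> oU; pose Q (q : rat * rat * nat) : set (R * R) :=
  ball ((ratr q.1.1, ratr q.1.2) : R * R) q.2.+1%:R^-1.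
have -> : U = \bigcup_q (if `[< Q q `<=` U >] then Q q else set0).
  apply/seteqP; split=> [p Up|p [q _]]; last by case: asboolP => // + Qp; exact.
  have /nbhs_ballP[e /= e0 eU] : nbhs p U by exact: open_nbhs_nbhs.
  have [n nlt] : exists n : nat, n.+1%:R^-1 < e / 2.
    have e2 : 0 <= (e / 2)^-1 by rewrite invr_ge0; lra.
    exists (Num.truncn (e / 2)^-1); rewrite -[ltRHS]invrK ltf_pV2 ?posrE ?invr_gt0//; last by lra.
    by have /andP[] := truncn_itv e2.
  have n0 : (0 : R) < n.+1%:R^-1 by rewrite invr_gt0.
  have near_rat (z : R) : exists q : rat, `|z - ratr q| < n.+1%:R^-1.
    have [|q] := @rat_in_itvoo R (z - n.+1%:R^-1) (z + n.+1%:R^-1).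
      by rewrite ltrBlDr -addrA ltrDl addr_gt0.
    by rewrite in_itv/= => qi; exists q; rewrite distrC ltr_distl.
  have tri (u v w d : R) : `|u - v| < d -> `|v - w| < d -> d < e / 2 -> `|u - w| < e.
    by move=> ? ? ?; have := ler_distD v u w; lra.
  have [q1 h1] := near_rat p.1; have [q2 h2] := near_rat p.2.
  exists ((q1, q2), n) => //; rewrite asboolT.
    by split; rewrite /ball/= distrC.
  move=> z [z1 z2]; apply: eU; rewrite /ball/= in z1 z2.
  by split; rewrite /ball/=; [exact: tri h1 z1 nlt|exact: tri h2 z2 nlt].
apply: countable_bigcupT_measurable => [|q]; first exact: countableP.
case: ifPn => _; last exact: measurable0.
have -> : Q q = ball (ratr q.1.1 : R) q.2.+1%:R^-1 `*` ball (ratr q.1.2 : R) q.2.+1%:R^-1.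
  by [].
by apply: measurableX; rewrite ball_itv; exact: measurable_itv.
Qed.

Lemma closed_measurable2 (A : set (R * R)) : closed A -> measurable (A : set plane).
Proof.
by move=> cA; rewrite -[A]setCK; apply: measurableC; apply: open_measurable2; exact: closed_openC.
Qed.

Lemma measurable_shear (alpha : R) :
  measurable_fun [set: plane] (fun p : plane => (p.1, p.2 + alpha * p.1) : plane).
Proof.
apply: measurable_fun_pair; first exact: measurable_fst.
apply: measurable_funD; first exact: measurable_snd.
by apply: measurable_funM; [exact: measurable_cst|exact: measurable_fst].
Qed.

Lemma measurable_shear_preimage (alpha : R) (A : set plane) : measurable A ->
  measurable ([set p | A (p.1, p.2 + alpha * p.1)] : set plane).
Proof. by move=> mA; rewrite -[X in measurable X]setTI; exact: measurable_shear. Qed.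

Lemma chord_set_ysection (alpha s : R) (A : set plane) :
  chord_set A alpha s = ysection [set p : plane | A (p.1, p.2 + alpha * p.1)] s.
Proof. by apply/seteqP; split => t; rewrite /ysection/= inE. Qed.

Lemma measurable_chord_set (alpha s : R) (A : set plane) : measurable A ->
  measurable (chord_set A alpha s).
Proof.
move=> mA; rewrite chord_set_ysection; apply: measurable_ysection.
exact: measurable_shear_preimage.
Qed.

Lemma measurable_fun_chord_set (alpha : R) (A : set plane) : measurable A ->
  measurable_fun [set: R] (fun s => mu (chord_set A alpha s)).
Proof.
move=> mA; under eq_fun do rewrite chord_set_ysection.
exact: (measurable_fun_ysection mu (measurable_shear_preimage alpha mA)).
Qed.

(** The shear translates every vertical section, so it preserves area, and horizontal sections of
    the sheared set are the chord sets. Uniqueness of the product measure permits the other order of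
    integration. *)
Lemma product_measure_chord (alpha : R) (A : set plane) : measurable A ->
  mu2 A = (\int[mu]_s mu (chord_set A alpha s))%E.
Proof.
move=> mA; have mB := measurable_shear_preimage alpha mA.
set B := [set p : plane | A (p.1, p.2 + alpha * p.1)] in mB.
transitivity (mu2 B).
  rewrite /product_measure1; apply: eq_integral => t _ /=.
  rewrite -(lebesgue_measure_translate (alpha * t) (measurable_xsection t mA)).
  by congr (mu _); apply/seteqP; split => s; rewrite /xsection/= !inE.
rewrite (@product_measure_unique _ _ _ _ R mu mu (mu \x^ mu)%E)//.
  by rewrite /product_measure2; apply: eq_integral => s _ /=; rewrite chord_set_ysection.
by move=> A1 A2 mA1 mA2; exact: product_measure2E.
Qed.

End PlaneMeasure.

(** * Area of a convex set *)

Section ConvexMeasure.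
Variable R : realType.
Local Notation mu := (@lebesgue_measure R).
Local Notation mu2 := ((@lebesgue_measure R) \x (@lebesgue_measure R))%E.
Local Notation plane := (measurableTypeR R * measurableTypeR R)%type.

Lemma C1_lipschitz_segment (f df : R -> R) (L : R) :
  (forall t, is_derive t (1 : R) f (df t)) -> continuous df -> 0 <= L ->
  exists2 M : R, 0 < M &
    forall s t, 0 <= s -> s <= t -> t <= L -> `|f t - f s| <= M * (t - s).
Proof.
move=> fd cdf L0.
have cn : continuous (fun t => `|df t|).
  by move=> t; apply: (@continuous_comp _ _ _ df Num.norm); [exact: cdf|exact: norm_continuous].
have [c _ cmax] := EVT_max L0 (continuous_subspaceT cn).
exists (`|df c| + 1); first by rewrite ltr_wpDl.
move=> s t s0 st tL; set M := `|df c| + 1.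
have bnd z : s < z < t -> `|df z| <= M.
  move=> /andP[sz zt]; apply: (@le_trans _ _ `|df c|); last by rewrite lerDl.
  by apply: cmax; rewrite in_itv/=; apply/andP; lra.
rewrite ler_norml; apply/andP; split.
  have := ler_increment (is_derive_mull (- M)) fd st.
  rewrite -mulrBr mulNr; apply => z /bnd.
  by rewrite ler_norml => /andP[].
have := ler_increment fd (is_derive_mull M) st.
rewrite -mulrBr; apply => z /bnd.
by rewrite ler_norml => /andP[].
Qed.

Lemma measurable_boundary (S : set (R * R)) : measurable (boundary S : set plane).
Proof.
apply: measurableD; first by apply: closed_measurable2; exact: closed_closure.
by apply: open_measurable2; exact: open_interior.
Qed.

Lemma measure_square (x y r : R) : 0 < r ->
  mu2 (`[x - r, x + r] `*` `[y - r, y + r])%classic = ((2 * r) ^+ 2)%:E.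
Proof.
move=> r0; rewrite product_measure1E//=.
rewrite !lebesgue_measure_itv/= !lte_fin !ltrBlDr -!addrA !ltrDl addr_gt0//.
by rewrite -!EFinB -EFinM; congr EFin; ring.
Qed.

Lemma boundary_null (S : set (R * R)) (L : R) (x y : R -> R) :
  C2_parametrization (boundary S) L x y -> mu2 (boundary S) = 0%E.
Proof.
move=> par; case: (par) => -[L0 _] [/C2_is_derive[dx ddx] /C2_is_derive[dy ddy]] _ _ _.
have [M1 M10 lx] := C1_lipschitz_segment dx (is_derive_continuous ddx) (ltW L0).
have [M2 M20 ly] := C1_lipschitz_segment dy (is_derive_continuous ddy) (ltW L0).
pose M := M1 + M2; have M0 : 0 < M by rewrite addr_gt0.
(* The curve is covered by [n.+2 <= 2 * n.+1] squares of side [2 * M * L / n.+1], of total area at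
   most [K / n.+1]; the last index is needed for [t = L]. *)
pose K := 8 * (M * L) ^+ 2.
have bound n : (mu2 (boundary S) <= (K / n.+1%:R)%:E)%E.
  have n0 : (0 : R) < n.+1%:R by [].
  pose d := L / n.+1%:R; have d0 : 0 < d by rewrite divr_gt0.
  pose r := M * d; have r0 : 0 < r by rewrite mulr_gt0.
  pose Q (i : nat) : set plane :=
    (`[x (i%:R * d) - r, x (i%:R * d) + r] `*` `[y (i%:R * d) - r, y (i%:R * d) + r])%classic.
  have mQ i : measurable (Q i) by apply: measurableX; exact: measurable_itv.
  have sub : (boundary S : set plane) `<=` \big[setU/set0]_(i < n.+2) Q i.
    move=> p /(boundary_curve par)[t /andP[t0 tL] ->].
    rewrite -(bigcup_mkord _ Q).
    pose i := Num.truncn (t / d).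
    have /andP[] := truncn_itv (divr_ge0 t0 (ltW d0)); rewrite -/i.
    rewrite ler_pdivlMr// ltr_pdivrMr// -natr1 mulrDl mul1r => it ti.
    exists i => /=.
      have : i%:R * d <= n.+1%:R * d.
        by apply: le_trans it _; rewrite mulrC divfK// gt_eqF.
      by rewrite ler_pM2r// ler_nat.
    have i0 : 0 <= i%:R * d by rewrite mulr_ge0// ltW.
    have M1r : M1 * (t - i%:R * d) <= r by rewrite ler_pM//; [exact: ltW|lra|rewrite lerDl ltW|lra].
    have M2r : M2 * (t - i%:R * d) <= r by rewrite ler_pM//; [exact: ltW|lra|rewrite lerDr ltW|lra].
    have := lx _ _ i0 it tL; have := ly _ _ i0 it tL; rewrite !ler_norml.
    move=> /andP[? ?] /andP[? ?]; split => /=; rewrite in_itv/=; apply/andP; lra.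
  apply: (@le_trans _ _ (mu2 (\big[setU/set0]_(i < n.+2) Q i))).
    by apply: le_measure; rewrite ?inE//; [exact: measurable_boundary|exact: bigsetU_measurable].
  apply: le_trans; first by apply: (@Boole_inequality _ R _ mu2 Q) => i _; exact: mQ.
  rewrite (eq_bigr (fun=> ((2 * r) ^+ 2)%:E)); last by move=> i _; exact: measure_square.
  rewrite sumEFin lee_fin sumr_const card_ord -[leLHS]mulr_natl.
  have -> : n.+2%:R * (2 * r) ^+ 2 = (n.+2%:R * 4 / n.+1%:R) * (M * L) ^+ 2 / n.+1%:R.
    have E (u k : R) : k != 0 ->
      u * (2 * (M * (L / k))) ^+ 2 = u * 4 / k * (M * L) ^+ 2 / k by move=> ?; field.
    by apply: E; rewrite pnatr_eq0.
  rewrite ler_pM2r ?invr_gt0// /K ler_wpM2r ?sqr_ge0// ler_pdivrMr//.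
  by rewrite -natrM -natrM ler_nat; lia.
apply/eqP; rewrite eq_le measure_ge0 andbT.
apply/lee_addgt0Pr => e e0; rewrite add0e.
have K0 : 0 <= K by rewrite mulr_ge0// sqr_ge0.
pose n := Num.truncn (K / e).
apply: le_trans (bound n) _; rewrite lee_fin ler_pdivrMr//.
have /andP[_] := truncn_itv (divr_ge0 K0 (ltW e0)); rewrite -/n ltr_pdivrMr// => /ltW.
by rewrite mulrC.
Qed.

Lemma chord_set_is_interval (S : set (R * R)) (alpha s : R) : convex2 S ->
  is_interval (chord_set S alpha s).
Proof.
move=> cS u v Iu Iv z /andP[uz zv].
have [uv|uv] := eqVneq u v; first by have -> : z = u by lra.
have uv0 : 0 < v - u by rewrite lt_neqAle eq_sym subr_eq0 eq_sym uv subr_ge0 (le_trans uz).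
pose t := (v - z) / (v - u).
have t01 : 0 <= t <= 1 by rewrite /t ler_pdivrMr// ler_pdivlMr//; apply/andP; lra.
have tE : t * (v - u) = v - z by rewrite divfK// gt_eqF.
have := chord_set_mix cS Iu Iv t01.
have -> : t * s + (1 - t) * s = s by ring.
by have -> : t * u + (1 - t) * v = z by lra.
Qed.

Lemma lebesgue_measure_chord (S : set (R * R)) (alpha s : R) :
  S `<=` @unit_square R -> convex2 S -> 
  mu (chord_set S alpha s) = (chord S alpha s)%:E.
Proof.
move=> Ssq cS; apply: lebesgue_measure_bounded_interval.
- exact: chord_set_is_interval.
- by exists 0 => t /(chord_set_itv Ssq)/andP[].
- by exists 1 => t /(chord_set_itv Ssq)/andP[_ /ltW].
Qed.

(** [S] is its interior together with a part of the boundary, and sets of outer measure zero are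
    Caratheodory measurable. *)
Lemma null_boundary_measurable2 (S : set (R * R)) : mu2 (boundary S) = 0%E ->
  lebesgue_measurable2 S.
Proof.
move=> B0; rewrite /lebesgue_measurable2.
have subc (A : set plane) : measurable A -> (mu2^*)%mu.-cara.-measurable A.
  by move=> mA; apply: sub_caratheodory; exact: sub_sigma_algebra.
have -> : S = S° `|` (S `&` boundary S).
  apply/seteqP; split => p.
    move=> Sp; have [|nip] := pselect (S° p); first by left.
    by right; split => //; split => //; exact: subset_closure.
  by case=> [/interior_subset|[]].
apply: (@caratheodory_measurable_setU _ _ (mu2^*)%mu).
  by apply: subc; apply: open_measurable2; exact: open_interior.
have Bext0 : (mu2^*)%mu (boundary S) = 0%E.
  by apply: etrans B0; apply: measurable_mu_extE; exact: measurable_boundary.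
apply: le_caratheodory_measurable => X.
apply: (@le_trans _ _ ((mu2^*)%mu (boundary S) + (mu2^*)%mu (X `&` ~` (S `&` boundary S))))%E.
  by rewrite leeD2r// le_outer_measure// => p [_ []].
rewrite Bext0 add0e.
by apply: le_outer_measure; exact: subIsetl.
Qed.

(** [S] may fail to be Borel, so the section formula is used for its interior and closure. These
    have equal area, and both sides of the claim lie in between. *)
Lemma lebesgue_measure2_convex (S : set (R * R)) (alpha : R) :
  S `<=` @unit_square R -> convex2 S -> mu2 (boundary S) = 0%E ->
  measurable_fun [set: R] (chord S alpha) ->
  lebesgue_measure2 S = (\int[mu]_s (chord S alpha s)%:E)%E.
Proof.
move=> Ssq cS B0 mg.
have mU : measurable (S° : set plane) by apply: open_measurable2; exact: open_interior.
have mC : measurable (closure S : set plane) by apply: closed_measurable2; exact: closed_closure.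
have UC : (mu2 (closure S) <= mu2 (S°))%E.
  have -> : closure S = S° `|` boundary S :> set plane.
    apply/seteqP; split => p.
      by move=> Sp; have [|nip] := pselect (S° p); [left|right].
    by case=> [/interior_subset/subset_closure|[]].
  rewrite -[leRHS]adde0 -B0; apply: measureU2 => //; exact: measurable_boundary.
have mfg : measurable_fun [set: R] (fun s => (chord S alpha s)%:E).
  by apply/measurable_EFinP.
have sub (A B : set (R * R)) s : A `<=` B -> measurable (chord_set A alpha s) ->
    measurable (chord_set B alpha s) -> (mu (chord_set A alpha s) <= mu (chord_set B alpha s))%E.
  by move=> AB mA mB; apply: le_measure; rewrite ?inE// => t /AB.
have mI s : measurable (chord_set S alpha s).
  by apply: measurable_bounded_interval; exact: chord_set_is_interval.
have lo : (mu2 (S°) <= \int[mu]_s (chord S alpha s)%:E)%E.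
  rewrite (product_measure_chord alpha mU); apply: ge0_le_integral => //.
  - exact: measurable_fun_chord_set.
  - move=> s _; rewrite -lebesgue_measure_chord//.
    by apply: sub => //; [exact: interior_subset|exact: measurable_chord_set].
have hi : (\int[mu]_s (chord S alpha s)%:E <= mu2 (closure S))%E.
  rewrite (product_measure_chord alpha mC); apply: ge0_le_integral => //.
  - by move=> s _; rewrite -lebesgue_measure_chord.
  - exact: measurable_fun_chord_set.
  - move=> s _; rewrite -lebesgue_measure_chord//.
    by apply: sub => //; [exact: subset_closure|exact: measurable_chord_set].
have lo' : (mu2 (S°) <= lebesgue_measure2 S)%E.
  rewrite -(measurable_mu_extE _ mU).
  by apply: (le_outer_measure (mu2^*)%mu); exact: interior_subset.
have hi' : (lebesgue_measure2 S <= mu2 (closure S))%E.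
  rewrite -(measurable_mu_extE _ mC).
  by apply: (le_outer_measure (mu2^*)%mu); exact: subset_closure.
apply/eqP; rewrite eq_le; apply/andP; split.
  exact: le_trans hi' (le_trans UC lo).
exact: le_trans hi (le_trans UC lo').
Qed.

Lemma integral_concave_bump (g Phi : R -> R) (a b c : R) : concave_bump g a b c ->
  (forall x, is_derive x (1 : R) Phi (g x)) ->
  (\int[mu]_s (g s)%:E = (Phi b - Phi a)%:E)%E.
Proof.
move=> gb dPhi; have [[ab _] _ gout _ _] := gb.
have lt : a - 1 < b + 1 by lra.
transitivity (\int[mu]_(s in `[(a - 1)%R, (b + 1)%R]) (g s)%:E)%E.
  rewrite [RHS]integral_mkcond; apply: eq_integral => s _.
  rewrite patchE; case: ifPn => //; rewrite notin_setE/= in_itv/= => h.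
  rewrite gout//; have [ax|xa] := leP a s; [right|left; exact: ltW].
  rewrite leNgt; apply/negP => sb; apply: h; apply/andP; lra.
rewrite (@continuous_FTC2 R g Phi (a - 1) (b + 1) lt).
- rewrite -EFinB (@antiderivative_right R g Phi a b c gb dPhi (b + 1) b); [|lra|lra].
  by rewrite (@antiderivative_left R g Phi a b c gb dPhi (a - 1) a)//; lra.
- exact/continuous_subspaceT/(concave_bump_continuous gb).
- have cP := is_derive_continuous dPhi; split.
  + by move=> x _; case: (dPhi x).
  + by apply: cvg_at_right_filter; exact: cP.
  + by apply: cvg_at_left_filter; exact: cP.
- by move=> x _; rewrite derive1E; have d := dPhi x; exact: derive_val.
Qed.

End ConvexMeasure.

(** * Reduction to the rotation of the circle *)

Section RotationTimes.
Variable R : realType.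
Local Notation mu := (@lebesgue_measure R).
Variables (S : set (R * R)) (alpha : R) (x : R * R) (m : nat).
Hypotheses (Ssq : S `<=` @unit_square R) (cS : convex2 S) (alpha0 : 0 < alpha).
Hypothesis (am : alpha + 3 <= m%:R).
Local Notation g := (chord S alpha).
Local Notation I := (chord_set S alpha).

Let y0 := x.2 - alpha * x.1.

Definition hitting_times : set R := [set t | S (rotation alpha x t)].

Let piece (n : nat) : set R := `[n%:R - x.1, n.+1%:R - x.1[%classic.

(** During [piece n] the lifted orbit is a line leaving the section at height [y0 + n alpha] modulo
    1; [slice n i] collects the times at which its vertical translate by [i - m] is in [S]. *)
Let slice (n i : nat) : set R :=
  [set t | I (frac_part (y0 + n%:R * alpha) + (i%:R - m%:R)) (t + (x.1 - n%:R))].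

Lemma frac_part_unique (u : R) (k : int) : 0 <= u - k%:~R < 1 -> frac_part u = u - k%:~R.
Proof.
move=> /andP[u0 u1]; rewrite /frac_part (_ : Num.floor u = k)//.
by apply: floor_def; rewrite intrD; apply/andP; lra.
Qed.

Lemma hitting_times_piece n :
  hitting_times `&` piece n = \big[setU/set0]_(i < m.*2) slice n i.
Proof.
have a0 := alpha0; have am' := am.
rewrite -(bigcup_mkord _ (slice n)).
pose z := y0 + n%:R * alpha; have zE := frac_partK z.
have /andP[fz0 fz1] := frac_part_itv z.
apply/seteqP; split => [t [St]|t [i /= im]]; rewrite /slice /= -/z.
  rewrite /piece /= in_itv/= -natr1 => /andP[t1 t2].
  have f1 : frac_part (x.1 + t) = t + (x.1 - n%:R).
    by rewrite (@frac_part_unique _ n%:Z) -?pmulrn; [ring|apply/andP; lra].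
  move: St; rewrite /hitting_times/= /rotation f1 => St.
  (* [K] counts vertical turns and [s] is the level left after removing them. Levels that meet [S]
     lie in [[-alpha, 1]], so [j + m] is a valid index. *)
  pose K := Num.floor (x.2 + alpha * t).
  pose s := z - K%:~R.
  have It : I s (t + (x.1 - n%:R)).
    rewrite /chord_set/=; move: St; congr (S (_, _)).
    by rewrite /frac_part /s /z /y0 -/K; ring.
  have /andP[s0 s1] := chord_set_level Ssq alpha0 It.
  pose j : int := Num.floor z - K.
  have jE : j%:~R = s - frac_part z :> R by rewrite /j intrD mulrNz /s; lra.
  have jm0 : 0 <= j + m%:Z.
    by rewrite -(ler0z R) intrD jE -pmulrn; lra.
  have jm1 : j + m%:Z < m.*2%:Z.
    by rewrite -(ltr_int R) intrD jE -!pmulrn -addnn natrD; lra.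
  exists (absz (j + m%:Z)); first by rewrite /=; lia.
  rewrite /slice/= -/z natr_absz (ger0_norm jm0) intrD jE -pmulrn.
  by have -> : frac_part z + (s - frac_part z + m%:R - m%:R) = s by ring.
set s := frac_part z + _ => It.
have /Ssq[/= s1 s2] := It.
split.
  rewrite /hitting_times/= /rotation; move: (It); rewrite /chord_set/=; congr (S (_, _)).
    rewrite (@frac_part_unique _ n%:Z) -?pmulrn; first by ring.
    by have -> : x.1 + t - n%:R = t + (x.1 - n%:R) by ring.
  pose K := Num.floor z + m%:Z - i%:Z.
  have e : x.2 + alpha * t - K%:~R = s + alpha * (t + (x.1 - n%:R)).
    have zdef : z = x.2 - alpha * x.1 + n%:R * alpha by [].
    by rewrite /K !intrD mulrNz -!pmulrn /s; lra.
  by rewrite (@frac_part_unique _ K) e.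
by rewrite /piece /= in_itv/= -natr1; move: s1 => /andP[? ?]; apply/andP; lra.
Qed.

Lemma measurable_slice n i : measurable (slice n i).
Proof.
apply: measurable_bounded_interval => u v Iu Iv w /andP[uw wv].
apply: (chord_set_is_interval cS Iu Iv); rewrite !lerD2r uw//.
Qed.

Lemma trivIset_slice n : trivIset setT (fun i : 'I_m.*2 => slice n i).
Proof.
apply/trivIsetP => i j _ _ ij; apply/seteqP; split => // t [] /Ssq[/= _ h1] /Ssq[/= _ h2].
case/eqP: ij; apply/val_inj => /=.
move: h1 h2; set u := frac_part _; set v := alpha * _ => /andP[? ?] /andP[? ?].
have l1 : (i%:R : R) < j%:R + 1 by lra.
have l2 : (j%:R : R) < i%:R + 1 by lra.
rewrite natr1 ltr_nat in l1; rewrite natr1 ltr_nat in l2.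
by apply/eqP; rewrite eqn_leq -ltnS l1 -ltnS l2.
Qed.

Lemma measurable_hitting_times_piece n : measurable (hitting_times `&` piece n).
Proof.
by rewrite hitting_times_piece; apply: bigsetU_measurable => i _; exact: measurable_slice.
Qed.

Lemma measure_hitting_times_piece n : mu (hitting_times `&` piece n) =
  (periodize m g (frac_part (y0 + n%:R * alpha)))%:E.
Proof.
rewrite hitting_times_piece.
rewrite (@measure_bigsetU_ord _ _ _ mu m.*2 xpredT (fun i => slice n i)); last 2 first.
- by move=> i; exact: measurable_slice.
- exact: trivIset_slice.
rewrite /periodize -sumEFin; apply: eq_bigr => i _.
rewrite -lebesgue_measure_chord//; apply: lebesgue_measure_translate.
by apply: measurable_bounded_interval; exact: chord_set_is_interval.
Qed.

(** Starting at [- x.1] instead of 0 makes this a union of complete pieces; the surplus has length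
    [x.1]. *)
Let upto (N : nat) : set R := `[- x.1, N%:R - x.1[%classic.

Let uptoS N : hitting_times `&` upto N.+1 =
  (hitting_times `&` upto N) `|` (hitting_times `&` piece N).
Proof.
rewrite -setIUr; congr (_ `&` _); apply/seteqP; split => t.
  rewrite /upto/piece/= !in_itv/= => /andP[? ?].
  by have [?|?] := ltP t (N%:R - x.1); [left|right]; apply/andP.
rewrite /upto/piece/= !in_itv/= -natr1; have : 0 <= N%:R :> R by [].
by move=> ? [|] /andP[? ?]; apply/andP; lra.
Qed.

Lemma measurable_hitting_times_upto N : measurable (hitting_times `&` upto N).
Proof.
elim: N => [|N IH]; first by rewrite /upto sub0r set_itvco0 setI0.
by rewrite uptoS; apply: measurableU => //; exact: measurable_hitting_times_piece.
Qed.

Lemma measure_hitting_times_upto N : mu (hitting_times `&` upto N) =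
  (\sum_(n < N) periodize m g (frac_part (y0 + n%:R * alpha)))%:E.
Proof.
elim: N => [|N IH]; first by rewrite /upto sub0r set_itvco0 setI0 measure0 big_ord0.
rewrite uptoS measureU.
- by rewrite big_ord_recr/= EFinD IH measure_hitting_times_piece.
- exact: measurable_hitting_times_upto.
- exact: measurable_hitting_times_piece.
- apply/seteqP; split => // t [[_ +] [_ +]]; rewrite /upto/piece/= !in_itv/=.
  by move=> /andP[_ h] /andP[+ _]; rewrite leNgt h.
Qed.

Lemma Rintegral_hitting_times (T : R) N : T < N%:R - x.1 -> 0 <= x.1 ->
  (\int[mu]_(t in `[0, T]) \1_S (rotation alpha x t))%R =
  fine (mu ((hitting_times `&` upto N) `&` `[0, T]%classic)).
Proof.
move=> TN x0; rewrite /Rintegral -integral_indic//; last exact: measurable_hitting_times_upto.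
congr fine; apply: eq_integral => t; rewrite inE/= in_itv/= => /andP[t0 tT].
congr EFin; rewrite !indicE; congr (nat_of_bool _)%:R.
apply/idP/idP; rewrite !inE; last by case.
by move=> St; split => //; rewrite /upto/= in_itv/=; apply/andP; lra.
Qed.

(** The integral is squeezed between the sums over [N] and [N.+1] complete pieces. The summand 1
    pays for the negative times, and [N + 1 <= T + 2] gives [2 * lam]. *)
Lemma discrepancy_bounded (lam B : R) : unit_square x -> 0 <= lam ->
  lebesgue_measure2 S = lam%:E ->
  (forall N y, `|\sum_(n < N) periodize m g (frac_part (y + n%:R * alpha))
     - N%:R * lam| <= B) ->
  forall T : R, 0 < T -> `|discrepancy S alpha x T| <= B + 1 + 2 * lam.
Proof.
move=> [/andP[x0 x1] _] lam0 Slam HB T T0.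
have xT : 0 <= x.1 + T by rewrite addr_ge0// ltW.
pose N := Num.truncn (x.1 + T).
have /andP[N0 N1] := truncn_itv xT; rewrite -/N in N0 N1.
have TN : T < N.+1%:R - x.1 by lra.
rewrite /discrepancy (Rintegral_hitting_times TN)// Slam/=.
set E := hitting_times `&` upto N.+1.
pose D : set R := `[0, T]%classic; pose D0 : set R := `[- x.1, 0[%classic.
rewrite -/D.
have mE : measurable E := measurable_hitting_times_upto _.
have mET : measurable (E `&` D) by apply: measurableI => //; exact: measurable_itv.
have up : (mu (E `&` D) <= mu E)%E.
  by apply: le_measure; rewrite ?inE//; exact: subIsetl.
rewrite measure_hitting_times_upto in up.
have fin : mu (E `&` D) \is a fin_num.
  by rewrite ge0_fin_numE ?measure_ge0// (le_lt_trans up)// ltry.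
have low : (mu (hitting_times `&` upto N) <= mu (E `&` D) + 1)%E.
  have m0 : measurable (D0) by exact: measurable_itv.
  apply: (@le_trans _ _ (mu ((E `&` D) `|` D0))%E).
    apply: le_measure; rewrite ?inE//; first exact: measurable_hitting_times_upto.
      exact: measurableU.
    move=> t [St]; rewrite /upto/= in_itv/= => /andP[t1 t2].
    have [t0|t0] := ltP t 0; [right|left]; first by rewrite /D0/= in_itv/= t0 t1.
    split; last by rewrite /D/= in_itv/= t0/=; lra.
    by split => //; rewrite /upto/= in_itv/= -natr1; apply/andP; lra.
  apply: le_trans; first by apply: measureU2.
  have D01 : (mu D0 <= 1)%E.
    rewrite /D0 lebesgue_measure_itv/= lte_fin; case: ifPn => _; last by rewrite lee_fin.
    by rewrite -EFinB lee_fin; lra.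
  exact: leeD2l D01.
rewrite measure_hitting_times_upto in low.
move: up low; rewrite -(fineK fin) -EFinD !lee_fin.
set J := fine _ => up low.
have := HB N y0; have := HB N.+1 y0; rewrite !ler_norml.
set b0 := \sum_(n < N) _ in low *; set b1 := \sum_(n < N.+1) _ in up *.
move=> /andP[_ h1] /andP[h0 _].
rewrite -natr1 in h1 N1.
have k1 : N%:R * lam <= (T + 1) * lam by rewrite ler_wpM2r//; lra.
have k2 : (T - 1) * lam <= N%:R * lam by rewrite ler_wpM2r//; lra.
rewrite -[fine J%:E]/J; apply/andP; lra.
Qed.

End RotationTimes.

Theorem theorem2 (R : realType) :
  {ae @lebesgue_measure R, forall alpha : R, 0 < alpha ->
    forall x : R * R, unit_square x ->
    forall S : set (R * R), S `<=` @unit_square R ->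
      convex_set (S : set (convex_lmodType (R * R)%type)) ->
      C2_curve_of_positive_curvature (boundary S) ->
      bounded_remainder_set S alpha x}.
Proof.
have := @ae_diophantine R.
apply: filterS; first exact: (ae_filter_ringOfSetsType (@lebesgue_measure R)).
move=> alpha aD a0 x xsq S Ssq /convex_set_convex2 cS curve.
have {}aD := aD a0.
have [a [b [c [gb aa b1 _]]]] := chord_concave_bump Ssq cS a0 curve.
have [L [px [py [par _]]]] := curve.
have B0 := boundary_null par.
have [Phi dPhi] := exists_antiderivative (concave_bump_continuous gb).
have mg : measurable_fun [set: R] (chord S alpha).
  by apply: continuous_measurable_fun; exact: concave_bump_continuous gb.
have Slam : lebesgue_measure2 S = (Phi b - Phi a)%:E.
  by rewrite (lebesgue_measure2_convex Ssq cS B0 mg) (integral_concave_bump gb dPhi).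
have lam0 : 0 <= Phi b - Phi a.
  rewrite -lee_fin -(integral_concave_bump gb dPhi); apply: integral_ge0 => s _.
  by rewrite lee_fin chord_ge0.
(* The support of the chord length lies in [[-alpha, 1]]; adding 4 leaves the margin 3 on both
   sides. *)
pose m := (Num.truncn (alpha + 4)).+1.
have am4 : alpha + 4 <= m%:R.
  have a40 : 0 <= alpha + 4 by lra.
  by have /andP[_ /ltW] := truncn_itv a40.
have am : alpha + 3 <= m%:R by lra.
have ma : 3 - m%:R <= a by lra.
have mb : b <= m%:R - 3 by lra.
have [B HB] := concave_bump_discrepancy gb ma mb dPhi a0 aD.
split; first split => //.
- exact: diophantine_irrational.
- exact: null_boundary_measurable2.
exists (B + 1 + 2 * (Phi b - Phi a)).
exact: (discrepancy_bounded Ssq cS a0 am xsq lam0 Slam HB).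
Qed.
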